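(* Let $n$ be a positive integer and let $\mathbf{G}=\{G_1,\dots,G_{2n-1}\}$ be a collection of $2n-1$ (not necessarily distinct) bipartite graphs on the same bipartition $V=(X,Y)$ with $|X|=|Y|=n$. If $\delta(G_i)\geq\left\lceil \frac{n+1}{2}\right\rceil$ for each $i\in[2n-1]$, then one of the following holds: (i) $\mathbf{G}$ is Hamiltonian connected, i.e. for any $x\in X$ and $y\in Y$ there exist a Hamiltonian path $P$ (a path with $V(P)=V$) with endpoints $x$ and $y$ and an injection $\phi:E(P)\to[2n-1]$ with $e\in E(G_{\phi(e)})$ for every $e\in E(P)$; (ii) $n$ is odd and $G_i\in\{F,F'\}$ for each $i\in[2n-1]$, where $F$ and $F'$ are the graphs on $(X,Y)$ defined below.
   Context: $[a]=\{1,\dots,a\}$; $\delta(G)$ is the minimum degree. For odd $n$, $F$ is the balanced bipartite graph with bipartition $(X,Y)$ where $X=\{x^*\}\cup X_1\cup X_2$ with $|X_1|=|X_2|=\frac{n-1}{2}$ and $Y=\{y^*\}\cup Y_1\cup Y_2$ with $|Y_1|=|Y_2|=\frac{n-1}{2}$ (disjoint unions), and $E(F)$ consists of all edges between $x^*$ and $Y_1\cup Y_2$, all edges between $y^*$ and $X_1\cup X_2$, and all edges between $X_i$ and $Y_i$ for $i=1,2$ (and no others). $F'$ is obtained from $F$ by adding the edge $x^*y^*$. Statement (ii) means there is such a choice of $x^*,y^*,X_1,X_2,Y_1,Y_2$ for which every $G_i$ equals $F$ or $F'$. *)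

(* Defs.v *)
From mathcomp Require Import all_boot.

Set Implicit Arguments.
Unset Strict Implicit.
Unset Printing Implicit Defensive.

(* A finite simple graph on the vertex set V, given by its set of edges, each
   edge being the two-element set of its endpoints. *)
Record sgraph (V : finType) := SGraph {
  edges : {set {set V}};
  edges_card2 : forall e, e \in edges -> #|e| = 2
}.

Section Graphs.

Variable V : finType.
Implicit Types (G : sgraph V) (X Y : {set V}) (u v x y : V) (p : seq V).

Definition neighbours G v : {set V} := [set u | [set v; u] \in edges G].

Definition degree G v : nat := #|neighbours G v|.

(* The default value #|V| bounds every degree, so this is the true minimum
   as soon as V is nonempty. *)
Definition min_degree G : nat := \big[minn/#|V|]_(v : V) degree G v.

Definition is_bipartition X Y : Prop := [disjoint X & Y] /\ X :|: Y = [set: V].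

Definition bipartite_on X Y G : Prop :=
  forall e, e \in edges G ->
    exists x y, [/\ x \in X, y \in Y & e = [set x; y]].

(* The path with vertex sequence x :: p has edge set path_edges x p. *)
Fixpoint path_edges x p : {set {set V}} :=
  if p is y :: q then [set x; y] |: path_edges y q else set0.

Definition hamiltonian_path x y p : Prop :=
  [/\ uniq (x :: p), last x p = y & forall v, v \in x :: p].

(* phi is only relevant on E(P); its values on other sets are arbitrary. *)
Definition transversal_on (k : nat) (G : 'I_k -> sgraph V)
    (E : {set {set V}}) (phi : {set V} -> 'I_k) : Prop :=
  {in E &, injective phi} /\ forall e, e \in E -> e \in edges (G (phi e)).

Definition hamiltonian_connected X Y (k : nat) (G : 'I_k -> sgraph V) : Prop :=
  forall x y, x \in X -> y \in Y ->
    exists (p : seq V) (phi : {set V} -> 'I_k),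
      hamiltonian_path x y p /\ transversal_on G (path_edges x p) phi.

(* A = {a} + A1 + A2 (disjoint union) with |A1| = |A2| = (n - 1) / 2; the
   halving is exact for the odd n to which this is applied. *)
Definition split_side (n : nat) (A : {set V}) (a : V) (A1 A2 : {set V}) : Prop :=
  [/\ A = a |: (A1 :|: A2), a \notin A1 :|: A2, [disjoint A1 & A2],
      #|A1| = (n - 1)./2 & #|A2| = (n - 1)./2].

Definition F_edges (xs ys : V) (X1 X2 Y1 Y2 : {set V}) : {set {set V}} :=
  [set [set xs; y] | y in Y1 :|: Y2]
  :|: [set [set x; ys] | x in X1 :|: X2]
  :|: [set [set x; y] | x in X1, y in Y1]
  :|: [set [set x; y] | x in X2, y in Y2].

Definition F'_edges (xs ys : V) (X1 X2 Y1 Y2 : {set V}) : {set {set V}} :=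
  [set xs; ys] |: F_edges xs ys X1 X2 Y1 Y2.

End Graphs.

(* Main.v *)
Require Import Defs.
From mathcomp Require Import all_boot zify.
From Stdlib Require Import Classical.

Set Implicit Arguments.
Unset Strict Implicit.
Unset Printing Implicit Defensive.

(* Fix x in X and y in Y, and delete both, leaving 2n - 2 vertices and 2n - 1
   colours of minimum degree at least (n - 1)/2.

   (1) The smaller collection has a rainbow Hamiltonian path, unless every colour
   is the same union of two balanced complete bipartite graphs, in which case the
   original degrees force F or F'. For this take an edge-maximal counterexample;
   adding an edge yields a Hamiltonian path, that is, two rainbow paths covering
   all vertices and avoiding three colours. Counting 2-opt exchanges for the two
   free ends rigidifies everything, three free colours making all of them equal.

   (2) A rainbow Hamiltonian path of the smaller collection has two spare colours;
   either its ends can be joined to y and x, or a 2-opt exchange closes it to a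
   rainbow Hamiltonian cycle with one spare colour a.

   (3) For such a cycle consider, for the edges (arcs) of one of its two perfect
   matchings, the number rho of 2-opt partners among the other edges (nodes) that
   use their own colour. Double counting, with x and y being adjacent to few
   vertices in those colours, shows that rho is large on average. If x and y can be
   inserted elsewhere at the cost of the colour of an arc, that arc becomes the only
   defective edge of a Hamiltonian cycle through xy, and repairing it by a 2-opt
   exchange bounds rho. For odd n an arc may resist, but then the neighbourhoods of
   x and y are so rigid that inserting them at a suitable node still works, the
   bound on rho now being attained only if some vertex has too large a degree. *)

(** * Alternating walks as lists of nodes *)

(* A node (a, l, b, k) is an edge ab of colour l followed by an edge of colour k
   leading to the next node, so a node list is an alternating walk. *)
Definition node (V C : Type) : Type := V * C * V * C.
Definition na V C (q : node V C) : V := q.1.1.1.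
Definition nl V C (q : node V C) : C := q.1.1.2.
Definition nb V C (q : node V C) : V := q.1.2.
Definition nk V C (q : node V C) : C := q.2.

Fixpoint verts V C (s : seq (node V C)) : seq V :=
  if s is q :: s' then na q :: nb q :: verts s' else [::].
Fixpoint cols V C (s : seq (node V C)) : seq C :=
  if s is q :: s' then nl q :: nk q :: cols s' else [::].
Definition hdv V C (s : seq (node V C)) (v : V) : V := if s is q :: _ then na q else v.

Definition lift V C (q : node V C) : node V (option C) :=
  (na q, Some (nl q), nb q, Some (nk q)).

Lemma verts_cat V C (s1 s2 : seq (node V C)) : verts (s1 ++ s2) = verts s1 ++ verts s2.
Proof. by elim: s1 => //= q s1 ->. Qed.

Lemma cols_cat V C (s1 s2 : seq (node V C)) : cols (s1 ++ s2) = cols s1 ++ cols s2.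
Proof. by elim: s1 => //= q s1 ->. Qed.

Lemma verts_lift V C (s : seq (node V C)) : verts (map (@lift V C) s) = verts s.
Proof. by elim: s => //= q s1 ->. Qed.

Lemma cols_lift V C (s : seq (node V C)) : cols (map (@lift V C) s) = map Some (cols s).
Proof. by elim: s => //= q s1 ->. Qed.

Lemma nb_lift V C (q : node V C) : nb (lift q) = nb q.
Proof. by []. Qed.

Lemma hdv_lift V C (s : seq (node V C)) v : hdv (map (@lift V C) s) v = hdv s v.
Proof. by case: s. Qed.

Lemma count_some (C : eqType) (P : pred C) cs : count (oapp P false) (map Some cs) = count P cs.
Proof. by rewrite count_map; apply: eq_count. Qed.

(* Both tactics compare the multiplicity of an arbitrary predicate on the two
   sides; the second one transfers hypotheses on [option]-valued lists. *)
Ltac perm_lia :=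
  lazymatch goal with |- is_true (@perm_eq ?T _ _) =>
  let P := fresh "P" in
  apply/permP => P;
  repeat match goal with
  | H : is_true (@perm_eq T _ _) |- _ => move/permP/(_ P) in H; revert H
  end;
  rewrite ?verts_cat ?cols_cat /= ?verts_cat ?cols_cat /= ?verts_lift ?cols_lift -?cats1 ?cat_cons ?map_cat ?count_cat /= ?count_cat /=;
  repeat match goal with |- context [nat_of_bool ?b] => move: (nat_of_bool b) => ? end;
  repeat match goal with |- context [count P ?b] => move: (count P b) => ? end;
  clear; lia end.

Ltac perm_lia_opt :=
  lazymatch goal with |- is_true (@perm_eq ?T _ _) =>
  let P := fresh "P" in
  apply/permP => P;
  repeat match goal with
  | H : is_true (@perm_eq T _ _) |- _ => move/permP/(_ P) in H; revert H
  | H : is_true (perm_eq _ _) |- _ => move/permP/(_ (oapp P false)) in H; revert H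
  end;
  rewrite ?verts_cat ?cols_cat /= ?verts_cat ?cols_cat /= ?verts_lift ?cols_lift -?cats1 ?cat_cons ?map_cat ?count_cat /= ?count_cat /=
    ?cols_lift ?map_cat ?count_cat ?count_some;
  repeat match goal with |- context [nat_of_bool ?b] => move: (nat_of_bool b) => ? end;
  repeat match goal with |- context [count P ?b] => move: (count P b) => ? end;
  clear; lia end.

(** * Walks with prescribed multisets of vertices and colours *)

Section Walk.
Variables (V C : eqType) (E : C -> rel V).

(* Only the multisets of vertices and colours of a walk are recorded, since the
   exchange moves below rearrange walks without changing these. *)
Inductive cwalk : V -> V -> seq V -> seq C -> Prop :=
| cwalk1 u : cwalk u u [:: u] [::]
| cwalkS c u v w vs cs vs' cs' : E c u v -> cwalk v w vs cs ->
    perm_eq vs' (u :: vs) -> perm_eq cs' (c :: cs) -> cwalk u w vs' cs'.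

Lemma cwalk_perm u w vs cs vs' cs' : cwalk u w vs cs ->
  perm_eq vs' vs -> perm_eq cs' cs -> cwalk u w vs' cs'.
Proof.
case=> [{}u pv pc|c {}u v {}w vs1 cs1 vs2 cs2 euv W pv pc pv' pc'].
  have -> := perm_small_eq (isT : size [:: u] <= 1) pv.
  have -> := perm_small_eq (isT : size [::] <= 1) pc.
  exact: cwalk1.
exact: cwalkS euv W (perm_trans pv' pv) (perm_trans pc' pc).
Qed.

Lemma cwalk_join u v v' w vs1 cs1 vs2 cs2 c vs cs :
  cwalk u v vs1 cs1 -> E c v v' -> cwalk v' w vs2 cs2 ->
  perm_eq vs (vs1 ++ vs2) -> perm_eq cs (c :: cs1 ++ cs2) -> cwalk u w vs cs.
Proof.
move=> W1 evv' W2; elim: W1 v' evv' vs cs W2 =>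
  [{}u|c1 {}u v1 {}v {}vs1 {}cs1 vs1' cs1' e1 _ IH pv pc] v' evv' vs cs W2 pv' pc'.
  by apply: cwalkS evv' W2 _ _.
apply: (cwalkS e1 (IH _ evv' _ _ W2 (perm_refl _) (perm_refl _))); perm_lia.
Qed.

Hypothesis Esym : forall c, symmetric (E c).

Lemma cwalk_rev u w vs cs : cwalk u w vs cs -> cwalk w u vs cs.
Proof.
elim=> [{}u|c {}u v {}w {}vs {}cs vs' cs' e _ IH pv pc]; first exact: cwalk1.
rewrite Esym in e.
apply: (cwalk_join IH e (cwalk1 u)); perm_lia.
Qed.

Lemma cwalk_ends u w vs cs : cwalk u w vs cs -> u \in vs /\ w \in vs.
Proof.
elim=> [{}u|c {}u v {}w {}vs {}cs vs' cs' e _ [_ IH] pv pc]; first by rewrite !inE eqxx.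
by rewrite !(perm_mem pv) !inE eqxx IH orbT.
Qed.

Lemma cwalk_split u w vs cs c : cwalk u w vs cs -> c \in cs ->
  exists a b vs1 vs2 cs1 cs2, [/\ cwalk u a vs1 cs1, cwalk b w vs2 cs2, E c a b,
    perm_eq vs (vs1 ++ vs2) & perm_eq cs (c :: cs1 ++ cs2)].
Proof.
elim=> [{}u //|c1 {}u v {}w {}vs {}cs vs' cs' e W IH pv pc].
rewrite (perm_mem pc) inE; have [ec _|nc /= cin] := eqVneq c c1.
    subst c1;
  by exists u, v, [:: u], vs, [::], cs; split=> //; exact: cwalk1.
have [a [b [vs1 [vs2 [cs1 [cs2 [W1 W2 eab pv2 pc2]]]]]]] := IH cin.
exists a, b, (u :: vs1), vs2, (c1 :: cs1), cs2; split=> //; try perm_lia.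
by apply: (cwalkS e W1).
Qed.

End Walk.

Lemma cwalk_sub (V C : eqType) (E E' : C -> rel V) u w vs cs :
  (forall c a b, c \in cs -> E c a b -> E' c a b) ->
  cwalk E u w vs cs -> cwalk E' u w vs cs.
Proof.
move=> EE' W; elim: W EE' => [{}u|c {}u v {}w {}vs {}cs vs' cs' e _ IH pv pc] EE'.
  exact: cwalk1.
have e' : E' c u v by apply: EE' e; rewrite (perm_mem pc) mem_head.
apply: (cwalkS e' (IH _) pv pc) => c1 a b c1in.
by apply: EE'; rewrite (perm_mem pc) inE c1in orbT.
Qed.

(* [None] is a virtual colour whose only edge joins [al] and [be]. *)
Section Virtual.
Variables (V C : eqType) (E : C -> rel V) (al be : V).
Hypothesis Esym : forall c, symmetric (E c).

Definition vrel (d : option C) : rel V := fun a b =>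
  if d is Some c then E c a b
  else (a == al) && (b == be) || (a == be) && (b == al).

Lemma vrel_sym d : symmetric (vrel d).
Proof.
case: d => [c|] a b; rewrite /vrel; first exact: Esym.
by rewrite orbC [(a == be) && _]andbC [(a == al) && _]andbC.
Qed.

Lemma cwalk_real u w vs ds : None \notin ds -> cwalk vrel u w vs ds ->
  exists cs, cwalk E u w vs cs /\ perm_eq ds (map Some cs).
Proof.
move=> nd W; elim: W nd => [{}u|d {}u v {}w {}vs {}ds vs' ds' e _ IH pv pd].
  by exists [::]; split=> //; exact: cwalk1.
rewrite (perm_mem pd) inE negb_or; case: d e pd => [c|//] e pd /andP[_ /IH[cs [W pc]]].
exists (c :: cs); split; first exact: (cwalkS (e : E c u v) W pv).
by apply: perm_trans pd _; rewrite /= perm_cons.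
Qed.

(** The edge from [e] back to [s] closes the walk to a cycle, and opening this cycle at its only
    virtual edge leaves a walk in real colours. *)
Lemma cwalk_virtual s e vs ds c : cwalk vrel s e vs ds -> E c e s ->
  count_mem None ds = 1 ->
  exists cs, cwalk E al be vs cs /\ perm_eq (None :: map Some cs) (Some c :: ds).
Proof.
move=> W ec n1.
have Nin : None \in ds by rewrite -has_pred1 has_count n1.
have [a [b [vs1 [vs2 [ds1 [ds2 [W1 W2 eab pv pd]]]]]]] := cwalk_split W Nin.
have := permP pd (pred1 None); rewrite n1 /= count_cat => n2.
have [|cs1 [R1 p1]] := cwalk_real _ W1; first by rewrite -has_pred1 has_count /=; lia.
have [|cs2 [R2 p2]] := cwalk_real _ W2; first by rewrite -has_pred1 has_count /=; lia.
have R : cwalk E b a vs (c :: cs1 ++ cs2).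
  by apply: (cwalk_join R2 ec R1); perm_lia.
have pfin : perm_eq (None :: map Some (c :: cs1 ++ cs2)) (Some c :: ds).
  rewrite /= map_cat; perm_lia.
exists (c :: cs1 ++ cs2); split=> //.
case/orP: eab => /andP[/eqP ea /eqP eb]; last by rewrite -ea -eb.
by apply: (cwalk_rev Esym); rewrite -ea -eb.
Qed.
End Virtual.

(** * Cutting and 2-opt exchange of alternating walks *)

Section NodeWalk.
Variables (V C : eqType) (E : C -> rel V).
Implicit Types (s t : seq (node V C)) (p q r : node V C).

Definition good q := E (nl q) (na q) (nb q).

Fixpoint chain s v :=
  if s is q :: s' then [&& good q, E (nk q) (nb q) (hdv s' v) & chain s' v] else true.

Definition linked c v s := if s is q :: _ then E c v (na q) else true.

(** Unlike in [chain], no edge is required of the colour [nk] of the last node: it is a spare colour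
    carried along in [cols]. *)
Fixpoint oc s :=
  if s is q :: s' then [&& good q, linked (nk q) (nb q) s' & oc s'] else true.

Lemma oc_cons p s : oc (p :: s) = [&& good p, linked (nk p) (nb p) s & oc s].
Proof. by []. Qed.

Lemma oc_split s1 p s2 : oc (s1 ++ p :: s2) = chain s1 (na p) && oc (p :: s2).
Proof.
elim: s1 => [|q s1 IH] //; rewrite cat_cons [LHS]/= IH /=.
by case: s1 {IH} => [|q' s1] /=; rewrite -!andbA.
Qed.

Lemma chain_cat s1 s2 v : chain (s1 ++ s2) v = chain s1 (hdv s2 v) && chain s2 v.
Proof.
elim: s1 => [|q s1 IH] //=; rewrite IH -!andbA.
by case: s1 {IH}.
Qed.

Lemma chain_oc q t v :
  chain (q :: t) v = oc (q :: t) && E (nk (last q t)) (nb (last q t)) v.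
Proof.
elim: t q => [|q' t IH] q; first by rewrite /= !andbT.
by rewrite [LHS]/= -/(chain (q' :: t) v) IH [RHS]/= -!andbA.
Qed.

Lemma chain_cwalk s v : chain s v -> cwalk E (hdv s v) v (rcons (verts s) v) (cols s).
Proof.
elim: s => [_|q s IH /and3P[gq lq /IH W]] /=; first exact: cwalk1.
by apply: (cwalkS gq (cwalkS lq W (perm_refl _) (perm_refl _))).
Qed.

Lemma oc_post p s : oc (p :: s) -> exists cs,
  cwalk E (nb p) (nb (last p s)) (nb p :: verts s) cs /\
  perm_eq (nk (last p s) :: cs) (nk p :: cols s).
Proof.
elim: s p => [|q s IH] p.
  by move=> _; exists [::]; split=> //; exact: cwalk1.
move=> /= /and3P[_ lp /[dup] oq /IH[cs [W pc]]].
have gq : good q by case/and3P: oq.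
exists (nk p :: nl q :: cs); split; last by perm_lia.
by apply: (cwalkS lp (cwalkS gq W (perm_refl _) (perm_refl _))).
Qed.

(** Deleting the edge of [r] cuts the walk in two and frees [nl r], besides the spare colour of the
    last node. *)
Lemma oc_cut q t r : oc (q :: t) -> r \in q :: t -> exists vs1 cs1 vs2 cs2,
  [/\ cwalk E (na q) (na r) vs1 cs1, cwalk E (nb r) (nb (last q t)) vs2 cs2, good r,
      perm_eq (verts (q :: t)) (vs1 ++ vs2)
    & perm_eq (cols (q :: t)) (nk (last q t) :: nl r :: cs1 ++ cs2)].
Proof.
move=> + rT; have -> : last q t = last r (q :: t) by [].
have -> : q = head r (q :: t) by [].
rewrite -[head r (q :: t) :: t]/(q :: t).
case/splitPr: rT => s1 s2; rewrite oc_split => /andP[/chain_cwalk W1 o2].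
have [cs [W2 pc]] := oc_post o2; rewrite last_cat /=.
have -> : na (head r (s1 ++ r :: s2)) = hdv s1 (na r) by case: (s1).
exists (rcons (verts s1) (na r)), (cols s1), (nb r :: verts s2), cs; split=> //; try perm_lia.
by case/and3P: o2.
Qed.

Hypothesis Esym : forall c, symmetric (E c).

(** The edge of [p] is deleted, the segment before it reversed, and the old initial vertex joined to
    [nb p] in colour [k]; [nl p] becomes free. *)
Lemma two_opt s1 p s2 k : oc (s1 ++ p :: s2) -> E k (hdv s1 (na p)) (nb p) ->
  exists cs, cwalk E (na p) (nb (last p s2)) (verts (s1 ++ p :: s2)) (k :: cs) /\
    perm_eq (nl p :: nk (last p s2) :: cs) (cols (s1 ++ p :: s2)).
Proof.
rewrite oc_split => /andP[/chain_cwalk W1 /oc_post[cs [W2 pc]]] ek.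
exists (cols s1 ++ cs); split; last by perm_lia.
by apply: (cwalk_join (cwalk_rev Esym W1) ek W2); perm_lia.
Qed.

End NodeWalk.

(** * Exchange through a virtual edge *)

Section VirtualNodes.
Variables (V C : eqType) (E : C -> rel V) (al be : V).
Hypothesis Esym : forall c, symmetric (E c).
Notation EV := (vrel E al be).
Implicit Types (T : seq (node V (option C))).

Lemma chain_lift (s : seq (node V C)) v : chain EV (map (@lift V C) s) v = chain E s v.
Proof. by elim: s => //= q s ->; rewrite hdv_lift. Qed.

Lemma linked_lift (s : seq (node V C)) c v :
  linked EV (Some c) v (map (@lift V C) s) = linked E c v s.
Proof. by case: s. Qed.

Lemma oc_lift (s : seq (node V C)) : oc EV (map (@lift V C) s) = oc E s.
Proof. by elim: s => //= q s ->; rewrite linked_lift. Qed.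

(** After the exchange at [r] the walk starts at [na r], so the edge of colour [k2] closes it to a
    cycle; opening this at the virtual edge gives a walk from [al] to [be], with [l] and [k]
    free. *)
Lemma virtual_two_opt T r l k k1 k2 : oc EV T -> r \in T -> nl r = Some l ->
  nk (last r T) = Some k -> count_mem None (cols T) = 1 ->
  E k1 (na (head r T)) (nb r) -> E k2 (nb (last r T)) (na r) ->
  exists cs, cwalk E al be (verts T) cs /\
    perm_eq (None :: Some l :: Some k :: map Some cs) (Some k1 :: Some k2 :: cols T).
Proof.
move=> + rT lr; case/splitPr: rT => s1 s2 oT; rewrite last_cat /= => lk n1 e1 e2.
have [|cs [W pc]] := two_opt (k := Some k1) (vrel_sym al be Esym) oT.
  by case: (s1) e1.
have [|cs' [W' pc']] := cwalk_virtual Esym W (c := k2) e2.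
  by have := permP pc (pred1 None); rewrite n1 /= lr lk /= => <-.
by exists cs'; split=> //; rewrite lr lk in pc; perm_lia.
Qed.
End VirtualNodes.

(** * Correspondence of walks and node lists in bipartite graphs *)

Section Bipartite.
Variables (V C : eqType) (E : C -> rel V) (X : pred V).
Hypothesis bip : forall c a b, E c a b -> X a = ~~ X b.
Implicit Types (s t : seq (node V C)) (p q r : node V C).

Definition sided D (q : node V D) := X (na q) && ~~ X (nb q).

Lemma cwalk_nodes_aux u w vs cs : cwalk E u w vs cs -> ~~ X w -> forall k,
  if X u then exists q t,
    [/\ oc E (q :: t), na q = u & nb (last q t) = w] /\
    [/\ nk (last q t) = k, perm_eq (verts (q :: t)) vs, perm_eq (cols (q :: t)) (k :: cs)
      & all (@sided C) (q :: t)]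
  else forall a l, exists c t,
    [/\ oc E t, linked E c u t & nb (last (a, l, u, c) t) = w] /\
    [/\ nk (last (a, l, u, c) t) = k, perm_eq (u :: verts t) vs, perm_eq (c :: cols t) (k :: cs)
      & all (@sided C) t].
Proof.
elim=> [{}u|c {}u v {}w {}vs {}cs vs' cs' e _ IH pv pc] Xw k.
  by rewrite (negbTE Xw) => a l; exists k, [::].
have := IH Xw k; have := bip e; case: (X v) => /= Xu; rewrite Xu.
  case=> q [t [[o hq lw] [lk p1 p2 al]]] /= a l; exists c, (q :: t); split; split=> //=.
  - by rewrite hq.
  - by perm_lia.
  - by perm_lia.
move=> /(_ u c)[c' [t [[o hq lw] [lk p1 p2 al]]]]; exists (u, c, v, c'), t.
have Xv : ~~ X v by have := bip e; rewrite Xu; case: (X v).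
split; split=> //=; try perm_lia.
- by rewrite /good /= e hq o.
- by rewrite /sided Xu Xv.
Qed.

Lemma cwalk_nodes u w vs cs k : cwalk E u w vs cs -> X u -> ~~ X w -> exists q t,
    [/\ oc E (q :: t), na q = u & nb (last q t) = w] /\
    [/\ nk (last q t) = k, perm_eq (verts (q :: t)) vs, perm_eq (cols (q :: t)) (k :: cs)
      & all (@sided C) (q :: t)].
Proof. by move=> W Xu Xw; have := cwalk_nodes_aux W Xw k; rewrite Xu. Qed.

Lemma cwalk_nodes_tail u w vs cs k a l : cwalk E u w vs cs -> ~~ X u -> ~~ X w -> exists c t,
    [/\ oc E t, linked E c u t & nb (last (a, l, u, c) t) = w] /\
    [/\ nk (last (a, l, u, c) t) = k, perm_eq (u :: verts t) vs, perm_eq (c :: cols t) (k :: cs)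
      & all (@sided C) t].
Proof. by move=> W Xu Xw; have := cwalk_nodes_aux W Xw k; rewrite (negbTE Xu); apply. Qed.

Lemma cwalk_chain u v vs cs : cwalk E u v vs cs -> X u -> X v -> exists t,
    [/\ chain E t v, hdv t v = u, perm_eq (rcons (verts t) v) vs, perm_eq (cols t) cs
      & all (@sided C) t].
Proof.
move=> W Xu Xv.
suff : if X u then exists t,
    [/\ chain E t v, hdv t v = u, perm_eq (rcons (verts t) v) vs, perm_eq (cols t) cs
      & all (@sided C) t]
  else exists c t, [/\ chain E t v, E c u (hdv t v), perm_eq (u :: rcons (verts t) v) vs,
      perm_eq (c :: cols t) cs & all (@sided C) t] by rewrite Xu.
elim: W Xv {Xu} => [{}u|c {}u w {}v {}vs {}cs vs' cs' e _ IH pv pc] Xv.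
  by rewrite Xv; exists [::].
have := IH Xv; have := bip e; case: (boolP (X w)) => /= Xw Xu; rewrite Xu.
  case=> t [o h p1 p2 al]; exists c, t; split=> //; try perm_lia.
  by rewrite h.
case=> c' [t [o h p1 p2 al]]; exists ((u, c, w, c') :: t); split=> //=; try perm_lia.
- by rewrite /good e h o.
- by rewrite /sided Xu Xw.
Qed.

Lemma count_sidedX D (s : seq (node V D)) c u : all (@sided D) s -> X u ->
  count (E c u) (verts s) = \sum_(r <- s) E c u (nb r).
Proof.
move=> + Xu; elim: s => [_|q s IH]; first by rewrite big_nil.
move=> /= /andP[/andP[Xa Xb] /IH ->]; rewrite big_cons.
case: (boolP (E c u (na q))) => [/bip|_]; last by rewrite add0n.
by rewrite Xa Xu.
Qed.

Lemma count_sidedY D (s : seq (node V D)) c u : all (@sided D) s -> ~~ X u ->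
  count (E c u) (verts s) = \sum_(r <- s) E c u (na r).
Proof.
move=> + Xu; elim: s => [_|q s IH]; first by rewrite big_nil.
move=> /= /andP[/andP[Xa Xb] /IH ->]; rewrite big_cons.
case: (boolP (E c u (nb q))) => [/bip|_]; last by lia.
by rewrite (negbTE Xu) (negbTE Xb).
Qed.

Lemma sided_nb (D : eqType) (s : seq (node V D)) v : all (@sided D) s -> v \in verts s -> ~~ X v ->
  exists2 q, q \in s & v = nb q.
Proof.
elim: s => //= q s IH /andP[/andP[Xa _] /IH{}IH].
rewrite !inE => /or3P[/eqP->|/eqP-> _|/IH{}IH /IH[r rs ->]]; first by rewrite Xa.
  by exists q; rewrite ?mem_head.
by exists r; rewrite // inE rs orbT.
Qed.

Lemma sided_na (D : eqType) (s : seq (node V D)) v : all (@sided D) s -> v \in verts s -> X v ->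
  exists2 q, q \in s & v = na q.
Proof.
elim: s => //= q s IH /andP[/andP[_ Xb] /IH{}IH].
rewrite !inE => /or3P[/eqP-> _|/eqP->|/IH{}IH /IH[r rs ->]].
- by exists q; rewrite ?mem_head.
- by rewrite (negbTE Xb).
by exists r; rewrite // inE rs orbT.
Qed.

End Bipartite.

(** * Counting over lists *)

Lemma size_verts V C (s : seq (node V C)) : size (verts s) = (size s).*2.
Proof. by elim: s => //= q s ->; rewrite doubleS. Qed.

Lemma mem_verts (V C : eqType) (s : seq (node V C)) q :
  q \in s -> na q \in verts s /\ nb q \in verts s.
Proof.
elim: s => //= r s IH; rewrite inE => /orP[/eqP->|/IH[H1 H2]].
  by rewrite !inE !eqxx orbT.
by rewrite !inE H1 H2 !orbT.
Qed.

Lemma sum_le_mul (T : eqType) (s : seq T) (F : T -> nat) M :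
  {in s, forall r, F r <= M} -> \sum_(r <- s) F r <= size s * M.
Proof.
elim: s => [|q s IH] H; first by rewrite big_nil.
rewrite big_cons /= mulSn leq_add ?H ?mem_head ?IH // => r rs.
by rewrite H // inE rs orbT.
Qed.

Lemma sum_eq_mul (T : eqType) (s : seq T) (F : T -> nat) M :
  {in s, forall r, F r <= M} -> size s * M <= \sum_(r <- s) F r -> {in s, forall r, F r = M}.
Proof.
elim: s => [|q s IH] // H; rewrite big_cons /=.
have Hs : {in s, forall r, F r <= M} by move=> r rs; rewrite H // inE rs orbT.
have := sum_le_mul Hs; have := H q (mem_head _ _) => H1 H2 H3 r.
rewrite inE => /orP[/eqP-> |]; first lia.
by apply: IH => //; lia.
Qed.

Lemma sum_le_size (T : eqType) (s : seq T) (F : T -> nat) :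
  {in s, forall r, F r <= 1} -> \sum_(r <- s) F r <= size s.
Proof. by move/sum_le_mul; rewrite muln1. Qed.

Lemma sum_eq_size (T : eqType) (s : seq T) (F : T -> nat) :
  {in s, forall r, F r <= 1} -> size s <= \sum_(r <- s) F r -> {in s, forall r, F r = 1}.
Proof. by move=> H h; apply: sum_eq_mul; rewrite ?muln1. Qed.

Lemma sum_gt_size (T : eqType) (s : seq T) (F : T -> nat) :
  size s < \sum_(r <- s) F r -> exists2 r, r \in s & 1 < F r.
Proof.
move=> h; apply/hasP; rewrite -[has _ _]negbK -all_predC; apply/negP => /allP H.
have : \sum_(r <- s) F r <= size s by apply: sum_le_size => r /H /=; rewrite -leqNgt.
by rewrite leqNgt h.
Qed.

(** * Cyclic lists and their arcs *)

Section Arcs.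
Variable T : eqType.
Implicit Types (s t : seq T) (z : T * T).

(** Cyclic succession: on a cycle of nodes, the pair of [p] and [p'] stands for the edge of colour
    [nk p] from [nb p] to [na p'], so arcs and node edges are the two perfect matchings. *)
Definition arcs s := zip s (rot 1 s).

Lemma mem_arcs q t z : z \in arcs (q :: t) ->
  z = (last q t, q) \/ exists s1 s2, q :: t = s1 ++ z.1 :: z.2 :: s2.
Proof.
rewrite /arcs rot1_cons; elim: t {1 3 5}q => [|p t IH] q' /=.
  by rewrite inE => /eqP->; left.
rewrite inE => /orP[/eqP->|/IH[->|[s1 [s2 es]]]]; [right|by left|right].
  by exists [::], t.
by exists (q' :: s1), s2; rewrite /= -es.
Qed.

Lemma arcs_rot i s : arcs (rot i s) = rot i (arcs s).
Proof.
have zd j : forall s1 s2, drop j (zip s1 s2) = zip (drop j s1) (drop j s2) :> seq (T * T).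
  elim: j => [|j IH] s1 s2; first by rewrite !drop0.
  by case: s1 s2 => [|q1 s1] [|q2 s2] //=; first [exact: IH | case: (drop j _)].
have zt j : forall s1 s2, take j (zip s1 s2) = zip (take j s1) (take j s2) :> seq (T * T).
  elim: j => [|j IH] s1 s2; first by rewrite !take0.
  by case: s1 s2 => [|q1 s1] [|q2 s2] //=; first [rewrite IH | case: (take j _)].
by rewrite /arcs rot_rot [rot i (rot 1 s)]/rot [rot i s in LHS]/rot zip_cat ?size_drop ?size_rot // -zd -zt.
Qed.

Lemma arcs_opening s z : z \in arcs s ->
  exists i t, rot i s = z.2 :: t /\ last z.2 t = z.1.
Proof.
case: s => [|q t] //; case/mem_arcs => [-> | [s1 [s2 es]]].
  by exists 0, t; rewrite rot0.
exists (size (rcons s1 z.1)), (s2 ++ rcons s1 z.1); split; last by rewrite last_cat last_rcons.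
by rewrite es -cat_rcons rot_size_cat.
Qed.

Lemma sum_arcs1 s (F : T -> nat) : \sum_(z <- arcs s) F z.1 = \sum_(q <- s) F q.
Proof. by rewrite -[in RHS](@unzip1_zip _ _ s (rot 1 s)) ?size_rot // big_map. Qed.

Lemma sum_arcs2 s (F : T -> nat) : \sum_(z <- arcs s) F z.2 = \sum_(q <- s) F q.
Proof.
rewrite -(perm_big _ (introT permPl (perm_rot 1 s))) /=.
by rewrite -[in RHS](@unzip2_zip _ _ s (rot 1 s)) ?size_rot // big_map.
Qed.

Lemma size_arcs s : size (arcs s) = size s.
Proof. by rewrite size_zip size_rot minnn. Qed.

Lemma arcs_rise s (P : pred T) : has P s -> ~~ all P s ->
  exists2 z, z \in arcs s & ~~ P z.1 && P z.2.
Proof.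
move=> hP; rewrite -has_predC => /hasP[q qs /= Pq]; have [i t et] := rot_to qs.
have : has P t by move: hP; rewrite -(has_rot i) et /= (negbTE Pq).
move=> hPt; suff [z] : exists2 z, z \in arcs (rot i s) & ~~ P z.1 && P z.2.
  by rewrite arcs_rot mem_rot; exists z.
rewrite et /arcs rot1_cons; elim: t {1 2}q Pq hPt {et} => [|p t IH] q' Pq //=.
case: (boolP (P p)) => [Pp _|Pp /= /(IH _ Pp)[z zi Pz]].
  by exists (q', p); rewrite ?mem_head //= Pq Pp.
by exists z; rewrite // inE zi orbT.
Qed.
End Arcs.

Lemma last_lift V C (p : node V (option C)) (q : node V C) t :
  nb p = nb q -> nk p = Some (nk q) ->
  nb (last p (map (@lift V C) t)) = nb (last q t) /\
  nk (last p (map (@lift V C) t)) = Some (nk (last q t)).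
Proof. by case: t => //= r t; rewrite last_map. Qed.

(** * A rainbow Hamiltonian path or a block structure *)

Section Blocks.
Variables (V C : finType) (X : pred V) (vs : seq V) (CS : seq C).
Hypothesis uvs : uniq vs.
Hypothesis uCS : uniq CS.

(** A path on [vs] has [size vs - 1] edges and there will be [(size vs).+1] colours, hence exactly
    two spare ones. *)
Definition ham_path (E : C -> rel V) := exists u w c c' cs,
  [/\ X u, ~~ X w, cwalk E u w vs cs & perm_eq (c :: c' :: cs) CS].

Definition two_paths (E : C -> rel V) u a vs1 cs1 b w vs2 cs2 k1 k2 k3 :=
  [/\ cwalk E u a vs1 cs1, cwalk E b w vs2 cs2, perm_eq vs (vs1 ++ vs2)
    & perm_eq (k1 :: k2 :: k3 :: cs1 ++ cs2) CS].

Section Rel.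
Variable E : C -> rel V.
Hypothesis Esym : forall c, symmetric (E c).
Hypothesis bip : forall c a b, E c a b -> X a = ~~ X b.
Hypothesis degE : forall c v, c \in CS -> v \in vs -> size vs <= 4 * count (E c v) vs.

(** Link [a] to [b] by a virtual edge and count, over the nodes, the edges from [u] in colour [k1]
    and from [w] in colour [k2]. A real node with both gives a path by 2-opt, and the virtual node
    has neither, since either edge would join the paths directly. So the sum is below the number of
    nodes, which the degrees forbid. *)
Lemma two_paths_odd u a vs1 cs1 b w vs2 cs2 k1 k2 k3 :
  two_paths E u a vs1 cs1 b w vs2 cs2 k1 k2 k3 ->
  X u -> X a -> ~~ X b -> ~~ X w -> ham_path E.
Proof.
move=> [W1 W2 pv pc] Xu Xa Xb Xw; apply: NNPP => nH.
have [t1 [ch1 h1 p1v p1c al1]] := cwalk_chain bip W1 Xu Xa.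
have [c0 [t2 [[o2 l2 lw] [lk p2v p2c al2]]]] := cwalk_nodes_tail bip k3 a k3 W2 Xb Xw.
pose p : node V (option C) := (a, None, b, Some c0).
pose T := map (@lift V C) t1 ++ p :: map (@lift V C) t2.
have oT : oc (vrel E a b) T.
  rewrite oc_split chain_lift ch1 /= /good /= !eqxx /=.
  by rewrite linked_lift oc_lift l2 o2.
have alT : all (@sided V X (option C)) T.
  rewrite all_cat /= !all_map; apply/and3P; split; [exact: al1| |exact: al2].
  by rewrite /sided Xa Xb.
have pT : perm_eq (verts T) vs by rewrite /T /p; perm_lia.
have hT r : na (head r T) = u by rewrite /T -h1; case: (t1).
have [lT1 lT2] := @last_lift _ _ p (a, k3, b, c0) t2 erefl erefl.
have laT r : nb (last r T) = w by rewrite /T last_cat /= lT1 lw.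
have lkT r : nk (last r T) = Some k3 by rewrite /T last_cat /= lT2 lk.
have uvs' : u \in vs by rewrite (perm_mem pv) mem_cat (cwalk_ends W1).1.
have wvs' : w \in vs by rewrite (perm_mem pv) mem_cat (cwalk_ends W2).2 orbT.
have k1C : k1 \in CS by rewrite -(perm_mem pc) mem_head.
have k2C : k2 \in CS by rewrite -(perm_mem pc) !inE eqxx orbT.
pose F (r : node V (option C)) := E k1 u (nb r) + E k2 w (na r).
have nN : count_mem None (cols T) = 1.
  have cN (s : seq C) : count_mem None (map Some s) = 0 by rewrite count_map; elim: s.
  by rewrite cols_cat /= !cols_lift count_cat /= !cN.
have FS r l : r \in T -> nl r = Some l -> F r <= 1.
  move=> rT lr; rewrite /F; case: (boolP (E k1 u (nb r))) => // e1; case: (boolP (E k2 w (na r))) => // e2.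
  have [||cs [W pcs]] := virtual_two_opt Esym oT rT lr (lkT r) nN (k1 := k1) (k2 := k2).
  - by rewrite hT.
  - by rewrite laT.
  case: nH; exists a, b, l, k3, cs; split=> //; first by apply: cwalk_perm W _ _; rewrite // perm_sym.
  rewrite /T /p in pcs; perm_lia_opt.
have Fp : F p = 0.
  rewrite /F /=; case: (boolP (E k1 u b)) => e1.
    case: nH; exists a, w, k2, k3, (k1 :: cs1 ++ cs2); split=> //; last by perm_lia.
    by apply: (cwalk_join (cwalk_rev Esym W1) e1 W2).
  case: (boolP (E k2 w a)) => // e2.
  case: nH; exists u, b, k1, k3, (k2 :: cs1 ++ cs2); split=> //; last by perm_lia.
  by rewrite Esym in e2; apply: (cwalk_join W1 e2 (cwalk_rev Esym W2)).
have := degE k1C uvs'; have := degE k2C wvs'.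
rewrite -!(permP pT) -(perm_size pT) size_verts.
rewrite (count_sidedX bip _ alT Xu) (count_sidedY bip _ alT Xw).
have : \sum_(r <- T) F r <= size t1 + size t2.
  rewrite /T big_cat big_cons /= Fp add0n leq_add //.
    rewrite -(size_map (@lift V C)); apply: sum_le_size => r rs.
    have rT : r \in T by rewrite mem_cat rs.
    by move: rs rT => /mapP[q _ ->] rT; apply: FS rT _.
  rewrite -(size_map (@lift V C)); apply: sum_le_size => r rs.
  have rT : r \in T by rewrite mem_cat inE rs !orbT.
  by move: rs rT => /mapP[q _ ->] rT; apply: FS rT _.
rewrite big_split /= /T size_cat /= !size_map.
set S1 := \sum_(r <- _) _; set S2 := \sum_(r <- _) _ => h3 h4 h5.
clear -h3 h4 h5; lia.
Qed.


Definition ends_sided u a b w := [/\ X u, ~~ X a, X b & ~~ X w].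

(* Every edge from [u] into the second path, or from [w] into the first one,
   rearranges the cover as in [two_paths_odd]; hence the sites of the 2-opt
   count are split exactly, which forces the two halves. *)
Lemma two_paths_even u a vs1 cs1 b w vs2 cs2 k1 k2 k3 : ~ ham_path E ->
  two_paths E u a vs1 cs1 b w vs2 cs2 k1 k2 k3 -> ends_sided u a b w ->
  (forall v, v \in vs -> ~~ X v -> E k1 u v = (v \in vs1)) /\ 4 * count (E k1 u) vs = size vs.
Proof.
move=> nH [W1 W2 pv pc] [Xu Xa Xb Xw].
have [q1 [t1 [[o1 h1 l1] [lk1 p1v p1c al1]]]] := cwalk_nodes bip k3 W1 Xu Xa.
have [q2 [t2 [[o2 h2 l2] [lk2 p2v p2c al2]]]] := cwalk_nodes bip k3 W2 Xb Xw.
have uvs' : u \in vs by rewrite (perm_mem pv) mem_cat (cwalk_ends W1).1.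
have wvs' : w \in vs by rewrite (perm_mem pv) mem_cat (cwalk_ends W2).2 orbT.
have k1C : k1 \in CS by rewrite -(perm_mem pc) mem_head.
have k2C : k2 \in CS by rewrite -(perm_mem pc) !inE eqxx orbT.
have N2 r : r \in q2 :: t2 -> E k1 u (nb r) = false.
  move=> rT; apply/negP => e1; apply: nH.
  have [us1 [ds1 [us2 [ds2 [V1 V2 gr pus pds]]]]] := oc_cut o2 rT.
  have /andP[Xr Yr] := allP al2 _ rT; rewrite h2 l2 lk2 in V1 V2 pds.
  have V3 : cwalk E a w (vs1 ++ us2) (k1 :: cs1 ++ ds2).
    by apply: (cwalk_join (cwalk_rev Esym W1) e1 V2).
  apply: (two_paths_odd (k1 := k2) (k2 := k3) (k3 := nl r) (And4 V1 V3 _ _)) => //; perm_lia.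
have N1 r : r \in q1 :: t1 -> E k2 w (na r) = false.
  move=> rT; apply/negP => e1; apply: nH.
  have [us1 [ds1 [us2 [ds2 [V1 V2 gr pus pds]]]]] := oc_cut o1 rT.
  have /andP[Xr Yr] := allP al1 _ rT; rewrite h1 l1 lk1 in V1 V2 pds.
  have V3 : cwalk E u b (us1 ++ vs2) (k2 :: ds1 ++ cs2).
    by rewrite Esym in e1; apply: (cwalk_join V1 e1 (cwalk_rev Esym W2)).
  apply: (two_paths_odd (k1 := k1) (k2 := k3) (k3 := nl r) (And4 V3 V2 _ _)) => //; perm_lia.
have [s1 [p [e1 e2]]] : exists s1 p, q1 :: t1 = rcons s1 p /\ last q1 t1 = p.
  by exists (belast q1 t1), (last q1 t1); rewrite lastI.
have hq : na q1 = hdv s1 (na p) by case: s1 e1 => [|? ?] [->].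
rewrite {}e1 in o1 p1v p1c al1 N1; rewrite {}e2 in l1 lk1; rewrite {}hq in h1.
(* Here the virtual edge from [a] to [b] runs between nodes, replacing the spare colour after the
   last node of the first path. *)
pose T := map (@lift V C) s1 ++ (na p, Some (nl p), nb p, None) :: map (@lift V C) (q2 :: t2).
have oT : oc (vrel E a b) T.
  move: o1; rewrite -cats1 !oc_split chain_lift => /andP[-> /andP[gp _]].
  rewrite andTb oc_cons oc_lift o2 andbT; apply/andP; split; first exact: gp.
  by change (vrel E a b None (nb p) (na q2)); rewrite l1 h2 /vrel !eqxx.
have alT : all (@sided V X (option C)) T.
  move: al1; rewrite all_rcons => /andP[sp s1s].
  by rewrite all_cat /= !all_map; apply/and3P; split; [exact: s1s|exact: sp|exact: al2].
have pT : perm_eq (verts T) vs by rewrite /T; rewrite -cats1 in p1v; perm_lia.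
have hT r : na (head r T) = u by rewrite /T -h1; case: (s1).
have laT r : last r T = lift (last q2 t2) by rewrite /T last_cat /= last_map.
have nN : count_mem None (cols T) = 1.
  have cN (s : seq C) : count_mem None (map Some s) = 0 by rewrite count_map; elim: s.
  by rewrite cols_cat /= !cols_lift count_cat /= !cN.
pose F (r : node V (option C)) := E k1 u (nb r) + E k2 w (na r).
have TS r : r \in T -> nl r != None.
  by rewrite mem_cat inE => /or3P[/mapP[? _ ->]|/eqP->|/mapP[? _ ->]].
have F1 : {in T, forall r, F r <= 1}.
  move=> r rT; have := TS _ rT; case lr : (nl r) => [l|] // _.
  rewrite /F; case: (boolP (E k1 u (nb r))) => // e1; case: (boolP (E k2 w (na r))) => // e2.
  have [|||cs [W pcs]] := virtual_two_opt Esym oT rT lr _ nN (k1 := k1) (k2 := k2) (k := k3).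
  - by rewrite laT /= lk2.
  - by rewrite hT.
  - by rewrite laT nb_lift l2.
  case: nH; exists b, a, l, k3, cs; split=> //.
    by apply: (cwalk_rev Esym); apply: cwalk_perm W _ _; rewrite // perm_sym.
  rewrite /T in pcs; rewrite -cats1 cols_cat /= lk1 in p1c; perm_lia_opt.
(* The two degrees already add up to the number of nodes, so both degree bounds are tight and every
   node contributes exactly one. *)
have [h4 sF] : 4 * count (E k1 u) vs = size vs /\ size T <= \sum_(r <- T) F r.
  have := sum_le_size F1; have := degE k1C uvs'; have := degE k2C wvs'.
  rewrite -!(permP pT) -(perm_size pT) size_verts.
  rewrite (count_sidedX bip _ alT Xu) (count_sidedY bip _ alT Xw) /F big_split /=.
  set S1 := \sum_(r <- _) _; set S2 := \sum_(r <- _) _ => h3 h4 h5.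
  by move: (size T) S1 S2 h3 h4 h5; clear; move=> n S1 S2 h3 h4 h5; split; lia.
have F2 := sum_eq_size F1 sF.
split=> // v; rewrite (perm_mem pv) mem_cat; case: (boolP (v \in vs1)) => [v1 _|_ v2] Xv; last first.
  by rewrite -(perm_mem p2v) in v2; have [q qT ->] := sided_nb al2 v2 Xv; rewrite N2.
rewrite -(perm_mem p1v) in v1; have [q qT ev] := sided_nb al1 v1 Xv.
have [r rT [er1 er2]] : exists2 r, r \in T & na r = na q /\ nb r = nb q.
  move: qT; rewrite mem_rcons inE => /orP[/eqP->|qs].
    by exists (na p, Some (nl p), nb p, None); rewrite // mem_cat mem_head orbT.
  by exists (lift q); rewrite // mem_cat map_f.
have := F2 r rT; rewrite /F er1 er2 -ev N1 // addn0 => /eqP.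
by rewrite eqb1.
Qed.

(* Rotating the first path at one of its sites turns any of its [X]-vertices into
   the initial one. *)
Lemma two_paths_first u a vs1 cs1 b w vs2 cs2 k1 k2 k3 x y : ~ ham_path E ->
  two_paths E u a vs1 cs1 b w vs2 cs2 k1 k2 k3 -> ends_sided u a b w ->
  x \in vs1 -> X x -> y \in vs -> ~~ X y ->
  E k2 x y = (y \in vs1) /\ 4 * count (E k2 x) vs = size vs.
Proof.
move=> nH TP ES x1 Xx yvs Xy; have [H _] := two_paths_even nH TP ES.
have [W1 W2 pv pc] := TP; have [Xu Xa Xb Xw] := ES.
have [q1 [t1 [[o1 h1 l1] [lk1 p1v p1c al1]]]] := cwalk_nodes bip k3 W1 Xu Xa.
rewrite -(perm_mem p1v) in x1; have [p pT ex] := sided_na al1 x1 Xx.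
have [_] := mem_verts pT; rewrite (perm_mem p1v) => p1.
have pvs : nb p \in vs by rewrite (perm_mem pv) mem_cat p1.
have Xp : ~~ X (nb p) by have /andP[_] := allP al1 _ pT.
have [us1 [ds1 [us2 [ds2 [V1 V2 gr pus pds]]]]] := oc_cut o1 pT.
have e1 : E k1 u (nb p) by rewrite H.
rewrite h1 l1 lk1 in V1 V2 pds.
have W3 : cwalk E x a vs1 (k1 :: ds1 ++ ds2).
  by rewrite ex; apply: (cwalk_join (cwalk_rev Esym V1) e1 V2); perm_lia.
have [|| H1 H2] := @two_paths_even x a vs1 (k1 :: ds1 ++ ds2) b w vs2 cs2 k2 k3 (nl p) nH.
- by split=> //; perm_lia.
- by split.
by rewrite H1.
Qed.

Lemma two_paths_swap u a vs1 cs1 b w vs2 cs2 k1 k2 k3 :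
  two_paths E u a vs1 cs1 b w vs2 cs2 k1 k2 k3 ->
  two_paths E b w vs2 cs2 u a vs1 cs1 k1 k2 k3.
Proof. by case=> W1 W2 pv pc; split=> //; perm_lia. Qed.

Lemma two_paths_free u a vs1 cs1 b w vs2 cs2 k1 k2 k3 x y : ~ ham_path E ->
  two_paths E u a vs1 cs1 b w vs2 cs2 k1 k2 k3 -> ends_sided u a b w ->
  x \in vs -> X x -> y \in vs -> ~~ X y ->
  E k2 x y = ((x \in vs1) == (y \in vs1)) /\ 4 * count (E k2 x) vs = size vs.
Proof.
move=> nH TP ES xvs Xx yvs Xy; have [_ _ pv _] := TP.
case: (boolP (x \in vs1)) => [x1|nx1].
  by have [-> ->] := two_paths_first nH TP ES x1 Xx yvs Xy.
have x2 : x \in vs2 by move: xvs; rewrite (perm_mem pv) mem_cat (negbTE nx1).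
have ES' : ends_sided b w u a by case: ES.
have [-> ->] := two_paths_first nH (two_paths_swap TP) ES' x2 Xx yvs Xy; split=> //.
move: uvs yvs; rewrite (perm_uniq pv) (perm_mem pv) mem_cat cat_uniq => /and3P[_ /hasPn/(_ y) n12 _].
case: (boolP (y \in vs1)) => [y1 _|_ /= -> //]; apply/negP => y2.
by have := n12 y2; rewrite /= y1.
Qed.

(* A colour used on one of the paths can be exchanged with a free one, all free
   colours containing the edges of both paths. *)
Lemma two_paths_blocks u a vs1 cs1 b w vs2 cs2 k1 k2 k3 x y c : ~ ham_path E ->
  two_paths E u a vs1 cs1 b w vs2 cs2 k1 k2 k3 -> ends_sided u a b w ->
  c \in CS -> x \in vs -> X x -> y \in vs -> ~~ X y ->
  E c x y = ((x \in vs1) == (y \in vs1)) /\ 4 * count (E c x) vs = size vs.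
Proof.
move=> nH TP ES cC xvs Xx yvs Xy; have [W1 W2 pv pc] := TP; have [Xu Xa Xb Xw] := ES.
have main k2' k1' k3' vs1' cs1' vs2' cs2' : two_paths E u a vs1' cs1' b w vs2' cs2' k1' k2' k3' ->
    E k2' x y = ((x \in vs1') == (y \in vs1')) /\ 4 * count (E k2' x) vs = size vs.
  by move=> TP'; apply: (two_paths_free nH TP' ES).
have F12 g h : g \in vs -> h \in vs -> X g = ~~ X h -> (g \in vs1) = (h \in vs1) -> E k2 g h.
  move=> gvs hvs; case: (boolP (X g)) => Xg /esym; last move/negbFE => Xh gh.
    move=> Xh gh.
    by have [-> _] := two_paths_free nH TP ES gvs Xg hvs Xh; rewrite gh.
  by rewrite Esym; have [-> _] := two_paths_free nH TP ES hvs Xh gvs Xg; rewrite gh.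
have vs12 v : v \in vs1 -> v \in vs by rewrite (perm_mem pv) mem_cat => ->.
have vs22 v : v \in vs2 -> v \in vs by rewrite (perm_mem pv) mem_cat orbC => ->.
have n12 v : v \in vs2 -> (v \in vs1) = false.
  move=> v2; apply/negP => v1; move: uvs; rewrite (perm_uniq pv) cat_uniq => /and3P[_ /hasPn/(_ v v2)].
  by rewrite /= v1.
move: cC; rewrite -(perm_mem pc) !inE mem_cat => /or4P[/eqP->|/eqP->|/eqP->|].
- by apply: (main k1 k2 k3 vs1 cs1 vs2 cs2); split=> //; perm_lia.
- exact: (main k2 k1 k3 vs1 cs1 vs2 cs2).
- by apply: (main k3 k2 k1 vs1 cs1 vs2 cs2); split=> //; perm_lia.
case/orP => [c1|c2].
  have [g [h [us1 [us2 [ds1 [ds2 [V1 V2 e pus pds]]]]]]] := cwalk_split W1 c1.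
  have g1 : g \in vs1 by rewrite (perm_mem pus) mem_cat (cwalk_ends V1).2.
  have h1 : h \in vs1 by rewrite (perm_mem pus) mem_cat (cwalk_ends V2).1 orbT.
  have e2 : E k2 g h by apply: F12; rewrite ?vs12 ?(bip e) ?g1 ?h1.
  have W3 : cwalk E u a vs1 (k2 :: ds1 ++ ds2) by apply: (cwalk_join V1 e2 V2).
  by apply: (main c k1 k3 vs1 (k2 :: ds1 ++ ds2) vs2 cs2); split=> //; perm_lia.
have [g [h [us1 [us2 [ds1 [ds2 [V1 V2 e pus pds]]]]]]] := cwalk_split W2 c2.
have g1 : g \in vs2 by rewrite (perm_mem pus) mem_cat (cwalk_ends V1).2.
have h1 : h \in vs2 by rewrite (perm_mem pus) mem_cat (cwalk_ends V2).1 orbT.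
have e2 : E k2 g h by apply: F12; rewrite ?vs22 ?(bip e) ?n12.
have W3 : cwalk E b w vs2 (k2 :: ds1 ++ ds2) by apply: (cwalk_join V1 e2 V2).
by apply: (main c k1 k3 vs1 cs1 vs2 (k2 :: ds1 ++ ds2)); split=> //; perm_lia.
Qed.

End Rel.

Lemma complete_walk (E : C -> rel V) xs ys x y cs : size xs = size ys -> size cs = (size xs).*2.+1 ->
  (forall c a b, c \in cs -> a \in x :: xs -> b \in y :: ys -> E c a b /\ E c b a) ->
  cwalk E x (last y ys) ((x :: xs) ++ y :: ys) cs.
Proof.
elim: xs ys x y cs => [|x2 xs IH] [|y2 ys] x y [|c [|c' cs]] //= es ec H.
  by apply: (cwalkS (proj1 (H c x y _ _ _)) (cwalk1 E y)); rewrite ?mem_head.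
have W : cwalk E x2 (last y2 ys) ((x2 :: xs) ++ y2 :: ys) cs.
  apply: IH; [by case: es|by case: ec|move=> c1 a b c1i ai bi].
  by apply: H; apply/predU1r => //; apply/predU1r.
have [e1 _] := H c x y (mem_head _ _) (mem_head _ _) (mem_head _ _).
have [_ e2] : E c' x2 y /\ E c' y x2 by apply: H; rewrite !inE eqxx ?orbT.
by apply: (cwalkS e1 (cwalkS e2 W (perm_refl _) (perm_refl _))); perm_lia.
Qed.

Definition add_edge (E : C -> rel V) c0 a0 b0 : C -> rel V := fun c a b =>
  E c a b || (c == c0) && ((a == a0) && (b == b0) || (a == b0) && (b == a0)).

(** Induction on the number of missing coloured edges: adding one yields either a path, which is cut
    at the colour of that edge, or a block structure, which is incompatible with the addition. *)
Lemma rainbow_path_or_blocks (E : C -> rel V) :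
  (forall c, symmetric (E c)) -> (forall c a b, E c a b -> X a = ~~ X b) ->
  (forall c v, c \in CS -> v \in vs -> size vs <= 4 * count (E c v) vs) ->
  count X vs = count (predC X) vs -> 0 < size vs -> size CS = (size vs).+1 ->
  ham_path E \/ exists A : pred V, forall c x y, c \in CS -> x \in vs -> X x -> y \in vs -> ~~ X y ->
    E c x y = (A x == A y) /\ 4 * count (E c x) vs = size vs.
Proof.
move=> Esym bip degE cX vs0 sCS.
have [n] := ubnP #|[set t : C * V * V | ~~ E t.1.1 t.1.2 t.2]|.
elim: n E Esym bip degE => // n IH E Esym bip degE le_n.
case: (classic (ham_path E)) => [|nH]; [by left | right].
(* If no edge between the sides is missing, any zigzag is a Hamiltonian path. *)
case: (classic (exists c a b, [/\ c \in CS, a \in vs, X a, b \in vs & ~~ X b /\ ~~ E c a b])); last first.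
  move=> full; case: nH.
  have H c a b : c \in CS -> a \in filter X vs -> b \in filter (predC X) vs -> E c a b.
    rewrite !mem_filter => cC /andP[Xa av] /andP[Xb bv]; apply/negPn/negP => ne.
    by case: full; exists c, a, b; split.
  have /permPl pf := perm_filterC X vs; have HX := filter_all X vs.
  have HY := filter_all (predC X) vs; rewrite -!size_filter in cX.
  move: cX H pf HX HY; case: (filter X vs) => [|x xs]; case: (filter (predC X) vs) => [|y ys] //=.
    by move=> _ _ pf; move: vs0; rewrite -(perm_size pf).
  move=> -[sxy] H pf /andP[Xx _] HY.
  have := perm_size pf; rewrite /= size_cat /= => sv.
  have [c [c' [cs eCS]]] : exists c c' cs, CS = c :: c' :: cs.
    by case: (CS) sCS => [|c [|c' cs]] //=; [lia|exists c, c', cs].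
  rewrite eCS /= -sv in sCS; exists x, (last y ys), c, c', cs; split=> //; last by rewrite eCS.
    by have /allP := HY : all (predC X) (y :: ys); apply; exact: mem_last.
  apply: cwalk_perm (complete_walk sxy (cs := cs) _ _) _ (perm_refl _); last by rewrite perm_sym.
    by case: sCS => ->; rewrite sxy addnS addnn.
  move=> c1 a b c1i ai bi; rewrite [E c1 b a]Esym.
  by have e : E c1 a b by apply: H => //; rewrite eCS; apply/predU1r/predU1r.
case=> c0 [a0 [b0 [cC av Xa bv [Xb ne]]]].
set E' := add_edge E c0 a0 b0.
have E's c : symmetric (E' c).
  move=> a b; rewrite /E' /add_edge Esym; congr (_ || _ && _).
  by rewrite orbC [(a == b0) && _]andbC [(a == a0) && _]andbC.
have E'b c a b : E' c a b -> X a = ~~ X b.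
  by case/orP=> [/bip //|/andP[_ /orP[]/andP[/eqP-> /eqP->]]]; rewrite Xa (negbTE Xb).
have EE' c a b : E c a b -> E' c a b by move=> e; rewrite /E' /add_edge e.
have E'deg c v : c \in CS -> v \in vs -> size vs <= 4 * count (E' c v) vs.
  move=> ci vi; apply: leq_trans (degE _ _ ci vi) _; rewrite leq_mul2l /=.
  by apply: sub_count => b; exact: EE'.
have [||[A HA]] := IH E' E's E'b E'deg.
- rewrite ltnS in le_n; apply: leq_trans le_n; apply: proper_card; apply/properP; split.
    by apply/subsetP => t; rewrite !inE; apply: contra; exact: EE'.
  by exists (c0, a0, b0); rewrite !inE //= /E' /add_edge !eqxx orbT.
- move=> [u [w [c [c' [cs [Xu Xw W pc]]]]]].
  have c0cs : c0 \in cs.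
    apply/negPn/negP => nc0; apply: nH; exists u, w, c, c', cs; split=> //.
    apply: cwalk_sub W => c1 a b c1i /orP[//|/andP[/eqP e]].
    by rewrite e (negbTE nc0) in c1i.
  have [a [b [vs1 [vs2 [cs1 [cs2 [W1 W2 e pv pcs]]]]]]] := cwalk_split W c0cs.
  have TP : perm_eq (c :: c' :: c0 :: cs1 ++ cs2) CS by perm_lia.
  move: (uCS); rewrite -(perm_uniq TP) /= !inE mem_cat => /and4P[_ _ nc0 _].
  have EE c1 g h : (c1 \in cs1) || (c1 \in cs2) -> E' c1 g h -> E c1 g h.
    by move=> c1i /orP[//|/andP[/eqP e1]]; rewrite e1 -mem_cat (negbTE nc0) in c1i.
  have {}W1 : cwalk E u a vs1 cs1 by apply: cwalk_sub W1 => c1 g h c1i; apply: EE; rewrite c1i.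
  have {}W2 : cwalk E b w vs2 cs2 by apply: cwalk_sub W2 => c1 g h c1i; apply: EE; rewrite c1i orbT.
  have T2 : two_paths E u a vs1 cs1 b w vs2 cs2 c c' c0 by split.
  (* The direction in which the added edge is traversed decides between the two kinds of path pairs:
     one gives a Hamiltonian path, the other the blocks. *)
  case/orP: e => [e|/andP[_ /orP[]/andP[/eqP ea /eqP eb]]].
  - case: nH; exists u, w, c, c', (c0 :: cs1 ++ cs2); split=> //.
    by apply: (cwalk_join W1 e W2).
  - by case: nH; apply: (two_paths_odd Esym bip degE T2); rewrite ?ea ?eb.
  exists (mem vs1) => c1 x y c1C xv Xx yv Xy.
  apply: (two_paths_blocks Esym bip degE nH T2) => //.
  by split=> //; rewrite ?ea ?eb.
(* In a block structure the degree of [a0] in [c0] has the least admissible value, but it was one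
   smaller before the edge was added. *)
case: (nH).
have e0 : E' c0 a0 b0 by rewrite /E' /add_edge !eqxx orbT.
have [_ h1] := HA c0 a0 b0 cC av Xa bv Xb.
have := degE _ _ cC av; rewrite -h1 leq_mul2l /= leqNgt => /negP[].
have -> : count (E' c0 a0) vs = count (E c0 a0) vs + count (pred1 b0) vs.
  rewrite -count_predUI -[LHS]addn0; congr (_ + _).
    apply: eq_count => b; rewrite /E' /add_edge /= !eqxx /=.
    suff -> : (a0 == b0) = false by rewrite orbF.
    by apply/eqP => ab; rewrite -ab Xa in Xb.
  apply/esym/eqP; rewrite -leqn0 leqNgt -has_count; apply/hasP => -[b _ /=].
  by move=> /andP[e /eqP eb]; rewrite eb in e; rewrite e in ne.
by rewrite -addn1 leq_add2l -has_count has_pred1.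
Qed.
End Blocks.

(** * From a Hamiltonian path to a Hamiltonian cycle *)

Section Cycles.
Variables (V C : finType) (X : pred V) (E : C -> rel V) (x y : V) (vs : seq V) (CS : seq C) (d : nat).
Hypothesis Esym : forall c, symmetric (E c).
Hypothesis bip : forall c a b, E c a b -> X a = ~~ X b.
Hypotheses (Xx : X x) (Xy : ~~ X y).
Hypothesis degE : forall c v, v \in x :: y :: vs -> d <= count (E c v) (x :: y :: vs).
Hypothesis d_big : size vs + 4 <= 4 * d.

Implicit Types (s t T : seq (node V C)).
Notation full_path := (cwalk E x y (x :: y :: vs) CS).

Definition cyc a s := [/\ chain E s (hdv s x), perm_eq (verts s) vs,
  perm_eq (a :: cols s) CS & all (@sided V X C) s].

Lemma cyc_cat a s1 s2 : cyc a (s1 ++ s2) -> cyc a (s2 ++ s1).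
Proof.
case=> ch pv pc al; split; try perm_lia; last by move: al; rewrite !all_cat andbC.
by move: ch; rewrite !chain_cat andbC; case: (s1) (s2) => [|q1 t1] [|q2 t2].
Qed.

Lemma cyc_rot a i s : cyc a s -> cyc a (rot i s).
Proof. by rewrite -{1}(cat_take_drop i s) => /cyc_cat. Qed.

Lemma cyc_degX a s c v : cyc a s -> v \in x :: y :: vs -> X v ->
  d <= E c v y + \sum_(r <- s) E c v (nb r).
Proof.
move=> [_ pv _ al] vi Xv; apply: leq_trans (degE c vi) _; rewrite /= -(permP pv).
rewrite (count_sidedX bip _ al Xv).
by case: (boolP (E c v x)) => // /bip; rewrite Xv Xx.
Qed.

Lemma cyc_degY a s c v : cyc a s -> v \in x :: y :: vs -> ~~ X v ->
  d <= E c v x + \sum_(r <- s) E c v (na r).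
Proof.
move=> [_ pv _ al] vi Xv; apply: leq_trans (degE c vi) _; rewrite /= -(permP pv).
rewrite (count_sidedY bip _ al Xv).
by case: (boolP (E c v y)) => [/bip|_]; rewrite ?(negbTE Xv) ?(negbTE Xy).
Qed.

Lemma cyc_size a s : cyc a s -> (size s).*2 = size vs.
Proof. by case=> _ /perm_size <- _ _; rewrite size_verts. Qed.

Lemma oc_walk q t : oc E (q :: t) -> exists cs,
  cwalk E (na q) (nb (last q t)) (verts (q :: t)) cs /\ perm_eq (nk (last q t) :: cs) (cols (q :: t)).
Proof.
move=> o; have [cs [W pc]] := oc_post o; exists (nl q :: cs); split; last by perm_lia.
by case/and3P: o => gq _ _; apply: (cwalkS gq W).
Qed.

(** Without a full path, at most one of the edges [u y] in colour [c] and [w x] in colour [c']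
    exists, so the degrees inside [vs] sum to at least [2 * d - 1], more than the number of nodes.
    Some node thus admits both exchange edges, and the path closes up. *)
Lemma cycle_of_path : ham_path X vs CS E -> ~ full_path -> exists a s, cyc a s.
Proof.
move=> [u [w [c [c' [cs [Xu Xw W pc]]]]]] nH.
have [q [t [[o hq lw] [lk pv pcs al]]]] := cwalk_nodes bip c' W Xu Xw.
have [ui wi] := cwalk_ends W.
have ui' : u \in x :: y :: vs by rewrite !inE ui !orbT.
have wi' : w \in x :: y :: vs by rewrite !inE wi !orbT.
have n1 : ~~ (E c u y && E c' w x).
  apply/negP => /andP[e1 e2]; apply: nH.
  rewrite Esym in e2; have W1 : cwalk E x u (x :: vs) (c' :: cs).
    by apply: (cwalkS e2 (cwalk_rev Esym W)).
  by apply: (cwalk_join W1 e1 (cwalk1 E y)); perm_lia.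
have [|r rT] := @sum_gt_size _ (q :: t) (fun r => E c u (nb r) + E c' w (na r)).
  rewrite -ltn_double -(size_verts (q :: t)) (perm_size pv).
  rewrite big_split /= -(count_sidedX bip _ al Xu) -(count_sidedY bip _ al Xw) !(permP pv).
  have := degE c ui'; have := degE c' wi'; rewrite /=.
  have -> : E c u x = false by apply/negP => /bip; rewrite Xu Xx.
  have -> : E c' w y = false by apply/negP => /bip; rewrite (negbTE Xw) (negbTE Xy).
  move: n1 d_big; move: (size vs) (count _ vs) (count _ vs).
  clear; case: (E c u y) => //=; case: (E c' w x) => //=; clear => n n1 n2 *; lia.
case: (boolP (E c u (nb r))) => // e1; case: (boolP (E c' w (na r))) => // e2 _.
have [Xr Yr] := andP (allP al _ rT).
have [cs' [W' pc']] : exists cs', cwalk E (na r) w vs (c :: cs') /\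
    perm_eq (nl r :: c' :: cs') (cols (q :: t)).
  have [us1 [ds1 [us2 [ds2 [V1 V2 gr pus pds]]]]] := oc_cut o rT.
  rewrite hq lw lk in V1 V2 pds; exists (ds1 ++ ds2); split; last by perm_lia.
  by apply: (cwalk_join (cwalk_rev Esym V1) e1 V2); perm_lia.
have [q' [t' [[o' hq' lw'] [lk' pv' pcs' al']]]] := cwalk_nodes bip c' W' Xr Xw.
exists (nl r), (q' :: t'); split=> //; last by perm_lia.
by rewrite chain_oc o' lk' lw' /= hq' e2.
Qed.

(** * Excluding Hamiltonian cycles in the absence of a full path *)

Section NoPath.
Hypothesis nH : ~ full_path.

(** Opening the cycle at the arc frees its colour; together with [a] this suffices to attach [x] and
    [y] to the two ends. *)
Lemma no_arc_insertion a q t c1 c2 : cyc a (q :: t) ->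
  perm_eq [:: c1; c2] [:: a; nk (last q t)] ->
  E c1 x (nb (last q t)) + E c2 y (na q) <= 1.
Proof.
move=> [+ pv pc _] p12; rewrite chain_oc => /andP[/oc_walk[cs [W pcs]] _].
case: (boolP (E c1 _ _)) => // e1; case: (boolP (E c2 _ _)) => // e2; case: nH.
rewrite Esym in e2.
have W1 := cwalkS e1 (cwalk_rev Esym W) (perm_refl _) (perm_refl _).
by apply: (cwalk_join W1 e2 (cwalk1 E y)); perm_lia.
Qed.

(** The same with the cycle opened at the edge of a node. *)
Lemma no_node_insertion a s r c1 c2 : cyc a s -> r \in s -> perm_eq [:: c1; c2] [:: a; nl r] ->
  E c1 x (nb r) + E c2 y (na r) <= 1.
Proof.
move=> + rs; case/splitPr: rs => s1 s2 /cyc_cat; rewrite cat_cons => -[ch pv pc _] p12.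
move: ch; rewrite [hdv _ _]/= => /and3P[_ l1 ch1]; have W := chain_cwalk ch1.
case: (boolP (E c1 _ _)) => // e1; case: (boolP (E c2 _ _)) => // e2; case: nH.
rewrite Esym in e2; have W0 := cwalkS l1 W (perm_refl _) (perm_refl _).
have W1 := cwalkS e1 W0 (perm_refl _) (perm_refl _).
by apply: (cwalk_join W1 e2 (cwalk1 E y)); perm_lia.
Qed.

(* Inserting [x, y] into another arc of the same kind keeps all nodes available
   for a 2-opt move closing the gap left by the arc from [last q t] to [q]. *)
Lemma two_opt_arc a q t s1 p p' s2 r k1 k2 : cyc a (q :: t) -> q :: t = s1 ++ p :: p' :: s2 ->
  E a x (nb p) -> E (nk (last q t)) y (na p') -> r \in q :: t ->
  perm_eq [:: k1; k2] [:: nk p; nl r] ->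
  E k1 (na q) (nb r) + E k2 (nb (last q t)) (na r) <= 1.
Proof.
move=> [+ pv pc _] eT ea ek rT p12; rewrite chain_oc => /andP[oT _].
set k := nk (last q t) in ek *.
pose T := map (@lift V C) s1 ++ (na p, Some (nl p), nb p, Some a) :: (x, None, y, Some k) ::
  map (@lift V C) (p' :: s2).
have oT' : oc (vrel E x y) T.
  rewrite eT oc_split oc_cons in oT; case/andP: oT => ch1 /and3P[gp lp op'].
  rewrite oc_split chain_lift ch1 andTb 2!oc_cons oc_lift op' andbT.
  apply/and4P; split; first exact: gp.
  - by change (E a (nb p) x); rewrite Esym.
  - by rewrite /good /= !eqxx.
  - exact: ek.
have laT : last q t = last p' s2.
  by rewrite -[LHS]/(last q (q :: t)) eT last_cat.
have [r' r'T [er1 er2 er3]] : exists2 r', r' \in T & [/\ na r' = na r, nb r' = nb r & nl r' = Some (nl r)].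
  move: rT; rewrite eT mem_cat inE => /or3P[rs|/eqP->|rs].
  - by exists (lift r); rewrite // mem_cat map_f.
  - by exists (na p, Some (nl p), nb p, Some a); rewrite // mem_cat mem_head orbT.
  - by exists (lift r); rewrite // mem_cat 2!in_cons (map_f _ rs) !orbT.
have laT' : last r' T = lift (last p' s2) by rewrite /T last_cat /= last_map.
have hT : na (head r' T) = na q by rewrite /T; case: (s1) eT => [|q1 s1'] [-> _].
have nN : count_mem None (cols T) = 1.
  have cN (s : seq C) : count_mem None (map Some s) = 0 by rewrite count_map; elim: s.
  by rewrite cols_cat /= !cols_lift count_cat /= !cN.
case: (boolP (E k1 _ _)) => // e1; case: (boolP (E k2 _ _)) => // e2; case: nH.
have [|||cs [W pcs]] := virtual_two_opt Esym oT' r'T er3 _ nN (k1 := k1) (k2 := k2) (k := k).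
- by rewrite laT' /k laT.
- by rewrite hT er2.
- by rewrite laT' nb_lift -laT er1.
apply: cwalk_perm W _ _.
  by rewrite eT in pv; rewrite /T; perm_lia.
rewrite eT in pc; rewrite /T in pcs; perm_lia_opt.
Qed.

(* The number of 2-opt moves of which a node [r] of [s], with its own colour,
   provides one edge for closing the gap left by the arc [z]. *)
Definition rho s (z : node V C * node V C) :=
  \sum_(r <- s) (E (nl r) (nb z.1) (na r) + E (nl r) (na z.2) (nb r)).

(* Inserting [y, x] into a node [j] replaces that node by two nodes containing
   [y] and [x]. *)
Lemma rho_node a q t j : cyc a (q :: t) -> j \in q :: t ->
  let k := nk (last q t) in E a x (nb j) -> E k y (na j) ->
  rho (q :: t) (last q t, q) + (E k (na q) y + E a (nb (last q t)) x) + 2 * d <=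
  2 * (size (q :: t)).+1 + (E (nl j) (nb (last q t)) (na j) + E (nl j) (na q) (nb j)).
Proof.
move=> [+ pv pc al] jT k ea ek; rewrite chain_oc => /andP[oT _].
have [s1 [s2 eT]] : exists s1 s2, q :: t = s1 ++ j :: s2.
  by case/splitPr: jT => s1 s2; exists s1, s2.
(* The node [j] becomes [na j], [y], [x], [nb j], with colours [k] and [a] around the virtual edge;
   its own colour [nl j] is set free. *)
pose T := map (@lift V C) s1 ++ (na j, Some k, y, None) :: (x, Some a, nb j, Some (nk j)) ::
  map (@lift V C) s2.
have oT' : oc (vrel E x y) T.
  rewrite eT oc_split oc_cons in oT; case/andP: oT => ch1 /and3P[gj lj o2].
  rewrite oc_split chain_lift ch1 andTb 2!oc_cons oc_lift o2 andbT linked_lift [nb (_, _)]/= lj andbT.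
  apply/and3P; split; first by change (E k (na j) y); rewrite Esym.
  - by change (vrel E x y None y x); rewrite /vrel !eqxx orbT.
  - by change (E a x (nb j)).
have laT : last q t = last j s2 by rewrite -[LHS]/(last q (q :: t)) eT last_cat.
have [lT1 lT2] := @last_lift _ _ (x, Some a, nb j, Some (nk j)) j s2 erefl erefl.
have laT1 r : nb (last r T) = nb (last q t) by rewrite /T last_cat /= lT1 laT.
have laT2 r : nk (last r T) = Some k by rewrite /T last_cat /= lT2 /k laT.
have hT r : na (head r T) = na q by rewrite /T; case: (s1) eT => [|q1 s1'] [-> _].
have nN : count_mem None (cols T) = 1.
  have cN (s : seq C) : count_mem None (map Some s) = 0 by rewrite count_map; elim: s.
  by rewrite cols_cat /= !cols_lift count_cat /= !cN.
have pT : perm_eq (verts T) (x :: y :: vs) by rewrite eT in pv; rewrite /T; perm_lia.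
have alT : all (@sided V X (option C)) T.
  have /andP[Xj Yj] := allP al _ jT.
  move: al; rewrite eT /T !all_cat /= !all_map => /and3P[a1 _ a2].
  by apply/and4P; split; [exact: a1|rewrite /sided Xj Xy|rewrite /sided Xx Yj|exact: a2].
pose u := na q; pose w := nb (last q t).
have pw r l k1 k2 : r \in T -> nl r = Some l -> perm_eq [:: k1; k2] [:: nl j; l] ->
    E k1 u (nb r) + E k2 w (na r) <= 1.
  move=> rT lr p12; case: (boolP (E k1 _ _)) => // e1; case: (boolP (E k2 _ _)) => // e2; case: nH.
  have [||cs [W pcs]] := virtual_two_opt Esym oT' rT lr (laT2 r) nN (k1 := k1) (k2 := k2).
  - by rewrite hT.
  - by rewrite laT1.
  apply: cwalk_perm W _ _; first by rewrite perm_sym.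
  by rewrite eT in pc; rewrite /T in pcs; perm_lia_opt.
pose eo (r : node V (option C)) v1 v2 := oapp (fun l => E l v1 v2) false (nl r).
have real r : r \in T -> exists l, nl r = Some l.
  rewrite mem_cat 2!in_cons => /or4P[/mapP[p _ ->]|/eqP->|/eqP->|/mapP[p _ ->]]; by eexists.
(* The colours [nl j] and that of [r] can be assigned to the two exchange edges in both ways; adding
   both versions gives two degrees in [nl j] plus the analogue of [rho] for [T]. *)
have h1 : \sum_(r <- T) (E (nl j) u (nb r) + eo r w (na r)) <= size T.
  apply: sum_le_size => r rT; have [l lr] := real r rT; rewrite /eo lr /=.
  exact: (pw r l _ _ rT lr (perm_refl _)).
have h2 : \sum_(r <- T) (eo r u (nb r) + E (nl j) w (na r)) <= size T.
  apply: sum_le_size => r rT; have [l lr] := real r rT; rewrite /eo lr /=.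
  by apply: (pw r l _ _ rT lr); perm_lia.
have /andP[Xu _] : sided X q by apply: (allP al); rewrite mem_head.
have /andP[_ Xw] : sided X (last q t) by apply: (allP al); rewrite mem_last.
have [qv _] := mem_verts (mem_head q t); have [_ wv] := mem_verts (mem_last q t).
rewrite (perm_mem pv) in qv; rewrite (perm_mem pv) in wv.
have d1 : d <= \sum_(r <- T) E (nl j) u (nb r).
  by rewrite -(count_sidedX bip _ alT Xu) (permP pT); apply: degE; rewrite !inE qv !orbT.
have d2 : d <= \sum_(r <- T) E (nl j) w (na r).
  by rewrite -(count_sidedY bip _ alT Xw) (permP pT); apply: degE; rewrite !inE wv !orbT.
have sT : size T = (size (q :: t)).+1 by rewrite eT !size_cat /= !size_map !addnS.
rewrite !big_split /= in h1 h2; rewrite -sT.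
(* Compared with [rho], the terms of [j] are replaced by those of the two new nodes. *)
have e3 : \sum_(r <- T) eo r w (na r) =
    \sum_(r <- s1) E (nl r) w (na r) + (E k w (na j) + (E a w x + \sum_(r <- s2) E (nl r) w (na r))).
  by rewrite /T big_cat !big_cons !big_map.
have e4 : \sum_(r <- T) eo r u (nb r) =
    \sum_(r <- s1) E (nl r) u (nb r) + (E k u y + (E a u (nb j) + \sum_(r <- s2) E (nl r) u (nb r))).
  by rewrite /T big_cat !big_cons !big_map.
have e5 : rho (q :: t) (last q t, q) =
    \sum_(r <- s1) E (nl r) w (na r) + (E (nl j) w (na j) + \sum_(r <- s2) E (nl r) w (na r)) +
    (\sum_(r <- s1) E (nl r) u (nb r) + (E (nl j) u (nb j) + \sum_(r <- s2) E (nl r) u (nb r))).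
  by rewrite /rho eT big_split /= !big_cat !big_cons.
rewrite e5 -/u -/w; move: h1 h2 d1 d2; rewrite e3 e4.
move: (size T) (\sum_(r <- T) _) (\sum_(r <- T) _) (\sum_(r <- s1) _) (\sum_(r <- s1) _)
  (\sum_(r <- s2) _) (\sum_(r <- s2) _).
move: (E k w (na j)) (E a w x) (E k u y) (E a u (nb j)) (E (nl j) w (na j)) (E (nl j) u (nb j)).
clear => b1 b2 b3 b4 b5 b6.
move: (nat_of_bool b1) (nat_of_bool b2) (nat_of_bool b3) (nat_of_bool b4) (nat_of_bool b5) (nat_of_bool b6).
lia.
Qed.

(** Summing [two_opt_arc] over all nodes for both orders of the colours [nk p] and [nl r] counts
    [rho] and two degrees in colour [nk p], each at least [d] up to one neighbour outside the
    cycle. *)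
Lemma rho_arc a q t s1 p p' s2 : cyc a (q :: t) -> q :: t = s1 ++ p :: p' :: s2 ->
  E a x (nb p) -> E (nk (last q t)) y (na p') ->
  rho (q :: t) (last q t, q) + 2 * d <= 2 * size (q :: t) + 2.
Proof.
move=> cT eT ea ek; have [_ pv _ al] := cT.
have opt := two_opt_arc cT eT ea ek.
have h1 : \sum_(r <- q :: t) (E (nk p) (na q) (nb r) + E (nl r) (nb (last q t)) (na r)) <= size (q :: t).
  by apply: sum_le_size => r rT; apply: opt.
have h2 : \sum_(r <- q :: t) (E (nl r) (na q) (nb r) + E (nk p) (nb (last q t)) (na r)) <= size (q :: t).
  by apply: sum_le_size => r rT; apply: opt => //; perm_lia.
have /andP[Xu _] : sided X q by apply: (allP al); rewrite mem_head.
have /andP[_ Xw] : sided X (last q t) by apply: (allP al); rewrite mem_last.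
have [qv _] := mem_verts (mem_head q t); have [_ wv] := mem_verts (mem_last q t).
rewrite (perm_mem pv) in qv; rewrite (perm_mem pv) in wv.
have uvs : na q \in x :: y :: vs by rewrite !inE qv !orbT.
have wvs : nb (last q t) \in x :: y :: vs by rewrite !inE wv !orbT.
have := cyc_degX (nk p) cT uvs Xu; have := cyc_degY (nk p) cT wvs Xw.
rewrite /rho big_split /=; rewrite !big_split /= in h1 h2; move: h1 h2.
move: (size t).+1 (\sum_(r <- q :: t) _) (\sum_(r <- q :: t) _) (\sum_(r <- q :: t) _) (\sum_(r <- q :: t) _).
move: (E _ _ x) (E _ _ y); clear => b1 b2 n S1 S2 S3 S4 h1 h2 h3 h4.
by case: b1 h3; case: b2 h4 => /= h3 h4; lia.
Qed.

Lemma sum_bool (T : Type) (s : seq T) (P : pred T) : \sum_(r <- s) (P r : nat) = count P s.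
Proof. by elim: s => [|r s IH]; rewrite ?big_nil // big_cons IH. Qed.

(** Interchanging the sums, [rho] adds up the degrees within the cycle of both ends of each node [r]
    in colour [nl r]. By [no_node_insertion] and the degrees of [x] and [y] in colour [a], the
    adjacencies of these ends to [x] and [y] number at most [2 * size s - 2 * (d - 1)]. *)
Lemma rho_sum a s (m : node V C -> nat) : cyc a s ->
  (forall r, r \in s -> m r <= \sum_(q <- s) E (nl r) (na r) (nb q) + E (nl r) (na r) y +
     (\sum_(q <- s) E (nl r) (nb r) (na q) + E (nl r) (nb r) x)) ->
  \sum_(r <- s) m r + 2 * d <= \sum_(z <- arcs s) rho s z + 2 * size s + 2.
Proof.
move=> cs Hm.
have h1 : \sum_(r <- s) (E a x (nb r) + E (nl r) y (na r)) <= size s.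
  by apply: sum_le_size => r rs; apply: (no_node_insertion cs rs).
have h2 : \sum_(r <- s) (E (nl r) x (nb r) + E a y (na r)) <= size s.
  by apply: sum_le_size => r rs; apply: (no_node_insertion cs rs); perm_lia.
have h3 := cyc_degX a cs (mem_head _ _) Xx.
have h4 : d <= E a y x + \sum_(r <- s) E a y (na r).
  by apply: cyc_degY cs _ Xy; rewrite !inE eqxx orbT.
have h5 : \sum_(z <- arcs s) rho s z =
    \sum_(r <- s) (\sum_(q <- s) E (nl r) (na r) (nb q) + \sum_(q <- s) E (nl r) (nb r) (na q)).
  rewrite exchange_big; apply: eq_bigr => r _; rewrite big_split /=; congr (_ + _).
    by rewrite (sum_arcs1 s (fun q => E (nl r) (nb q) (na r))); apply: eq_bigr => q _; rewrite Esym.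
  by rewrite (sum_arcs2 s (fun q => E (nl r) (na q) (nb r))); apply: eq_bigr => q _; rewrite Esym.
have h6 : \sum_(r <- s) m r <= \sum_(z <- arcs s) rho s z +
    (\sum_(r <- s) E (nl r) y (na r) + \sum_(r <- s) E (nl r) x (nb r)).
  rewrite h5 -!big_split /= big_seq [X in _ <= X]big_seq; apply: leq_sum => r rs.
  by have := Hm r rs; rewrite [E _ _ x]Esym [E _ _ y]Esym addnACA.
rewrite !big_split /= in h1 h2; move: h1 h2 h3 h4 h6.
move: (\sum_(r <- s) _) (\sum_(r <- s) _) (\sum_(r <- s) _) (\sum_(r <- s) _) (\sum_(r <- s) _)
  (\sum_(r <- arcs s) _).
move: (size s) (E _ _ x) (E _ _ y); clear => n b1 b2 S1 S2 S3 S4 S5 S6.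
by case: b1; case: b2 => /=; lia.
Qed.

(** The excluded insertions and degree at least two force edges from [x] to [nb q0] in colour
    [nk q1] and from [na q0] to [nb q1] in colour [nl q0]; then [x], [nb q0], [na q1], [nb q1],
    [na q0], [y] is a full path. *)
Lemma no_square_aux a q0 q1 : 2 <= d -> cyc a [:: q0; q1] -> E a x (nb q0) -> E a y (na q0) -> False.
Proof.
move=> d2 c2 ex ey; have [ch pv pc _] := c2; apply: nH.
have xi : x \in x :: y :: vs by rewrite mem_head.
have ai : na q0 \in x :: y :: vs by rewrite !inE -(perm_mem pv) /= !inE eqxx !orbT.
have [_ _ _ /and3P[/andP[X0 _] _ _]] := c2.
have := no_arc_insertion (c1 := nk q1) (c2 := a) c2; rewrite /= ey => n1.
have := no_node_insertion (c1 := a) (c2 := nl q0) c2 (mem_head _ _) (perm_refl _); rewrite ex => n2.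
have ex0 : E (nk q1) x (nb q0).
  have := cyc_degX (nk q1) c2 xi Xx; rewrite !big_cons big_nil.
  have {}n1 : E (nk q1) x (nb q1) = false by have := n1 ltac:(perm_lia); case: (E _ _ _).
  by move: d2; rewrite n1; case: (E _ x y); case: (E _ x (nb q0)) => //=; clear; lia.
have eb : E (nl q0) (na q0) (nb q1).
  have := cyc_degX (nl q0) c2 ai X0; rewrite !big_cons big_nil.
  have {}n2 : E (nl q0) (na q0) y = false by rewrite Esym; move: n2; case: (E _ _ _).
  by move: d2; rewrite n2; case: (E _ _ (nb q1)); case: (E _ _ (nb q0)) => //=; clear; lia.
move: ch => /= /and3P[_ e1 /and3P[e2 _ _]].
rewrite Esym in ey; rewrite Esym in eb.
have W1 := cwalkS ey (cwalk1 E y) (perm_refl _) (perm_refl _).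
have W2 := cwalkS eb W1 (perm_refl _) (perm_refl _).
have W3 := cwalkS e2 W2 (perm_refl _) (perm_refl _).
have W4 := cwalkS e1 W3 (perm_refl _) (perm_refl _).
by apply: (cwalkS ex0 W4); perm_lia.
Qed.

(* For the 4-cycle the counting argument is one unit short; here [x] and [y] can be
   attached in colour [a] to the ends of a common edge of the cycle. *)
Lemma no_square a q0 q1 : 2 <= d -> cyc a [:: q0; q1] -> False.
Proof.
move=> d2 c2.
(* Traversing the cycle backwards exchanges its two perfect matchings, turning arcs into nodes. *)
have refl p0 p1 : cyc a [:: p0; p1] -> cyc a [:: (na p1, nk p0, nb p0, nl p0); (na p0, nk p1, nb p1, nl p1)].
  case=> /= /and3P[l1 e1 /and3P[l2 e2 _]] pv pc /and3P[/andP[s1 s2] /andP[s3 s4] _]; split.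
  - by rewrite /= /good /= !(Esym _ _ (nb _)) e1 e2 !(Esym _ (nb _)) [E _ _ _]l1 [E _ _ _]l2.
  - by perm_lia.
  - by perm_lia.
  - by rewrite /= /sided /= s1 s2 s3 s4.
have c2' : cyc a [:: q1; q0] := cyc_cat (s1 := [:: q0]) c2.
have yi : y \in x :: y :: vs by rewrite !inE eqxx orbT.
have := cyc_degX a c2 (mem_head _ _) Xx; have := cyc_degY a c2 yi Xy; rewrite !big_cons !big_nil.
case: (boolP (E a y (na q0))) => [y0|_].
  case: (boolP (E a x (nb q0))) => [x0|_].
    by case: (no_square_aux d2 c2 x0 y0).
  case: (boolP (E a x (nb q1))) => [x1|_]; last by move: d2; case: (E a x y) => /=; clear; lia.
  by case: (no_square_aux d2 (refl _ _ c2')).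
case: (boolP (E a y (na q1))) => [y1|_]; last by move: d2; case: (E a y x) => /=; clear; lia.
case: (boolP (E a x (nb q1))) => [x1|_].
  by case: (no_square_aux d2 c2' x1 y1).
case: (boolP (E a x (nb q0))) => [x0|_]; last by move: d2; case: (E a x y) => /=; clear; lia.
by case: (no_square_aux d2 (refl _ _ c2)).
Qed.

Lemma sum_const (T : Type) (s : seq T) M : \sum_(r <- s) M = size s * M.
Proof. by rewrite big_const_seq count_predT iter_addn_0 mulnC. Qed.

(** With [N] nodes, the average of [rho] is at least [N + 1], whereas no arc exceeds this value and
    equality everywhere leaves only the 4-cycle. *)
Lemma no_cycle a s : 0 < size vs -> ~ cyc a s.
Proof.
move=> vs0 cs; have sz := cyc_size cs.
pose N := size s; have sN : size (arcs s) = N by rewrite size_arcs.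
have D : N + 2 <= 2 * d by move: d_big sz; rewrite -/N; move: (size vs) => n; lia.
have N0 : 0 < N by move: sz vs0; rewrite -/N; move: (size vs) => n; lia.
have deg2 r : r \in s -> d <= \sum_(q <- s) E (nl r) (na r) (nb q) + E (nl r) (na r) y /\
    d <= \sum_(q <- s) E (nl r) (nb r) (na q) + E (nl r) (nb r) x.
  move=> rs; have [_ pv _ al] := cs; have /andP[Xr Yr] := allP al _ rs.
  have [] := mem_verts rs; rewrite !(perm_mem pv) => rv1 rv2; rewrite ![_ + E _ _ _]addnC.
  by split; [apply: cyc_degX cs _ Xr|apply: cyc_degY cs _ Yr]; rewrite !inE ?rv1 ?rv2 !orbT.
have lb : N * (2 * d) + 2 * d <= \sum_(z <- arcs s) rho s z + 2 * N + 2.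
  rewrite -sum_const; apply: (rho_sum cs) => r /deg2[h1 h2].
  by rewrite mul2n -addnn leq_add.
have op z : z \in arcs s -> exists t, [/\ cyc a (z.2 :: t), last z.2 t = z.1, perm_eq (z.2 :: t) s
    & arcs (z.2 :: t) =i arcs s].
  case/arcs_opening => i [t [et lt]]; exists t; rewrite -et; split=> //.
  - exact: cyc_rot.
  - by rewrite perm_rot.
  - by move=> z'; rewrite arcs_rot mem_rot.
(* An arc [z] with [R z] resists: no arc offers an insertion of [x] and [y] using [a] and the colour
   of [z]. *)
pose R (z : node V C * node V C) := all (fun z' => E a x (nb z'.1) + E (nk z.1) y (na z'.2) <= 1) (arcs s).
have A z : z \in arcs s -> ~~ R z -> rho s z + 2 * d <= 2 * N + 2.
  move=> zs; have [t [ct lt pt at_]] := op z zs.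
  case/allPn => z' z's; case: (boolP (E a x _)) => // ex; case: (boolP (E _ y _)) => // ey _.
  have := z's; rewrite -at_ => /mem_arcs[ez|[s1 [s2 es]]].
    have := no_arc_insertion ct (perm_refl _).
    by rewrite ez /= in ex ey; rewrite ex lt ey.
  rewrite -lt in ey; have := rho_arc ct es ex ey.
  by rewrite lt /rho (perm_big _ pt) (perm_size pt).
(* The degrees of [x] and [y] on the cycle, each at least [d - 1], add up to at least [N], so
   resistance forces equality throughout. *)
have RX z : z \in arcs s -> R z -> 2 * d = N + 2 /\ \sum_(q <- s) E a x (nb q) = d.-1 /\
    {in arcs s, forall z', E a x (nb z'.1) + E (nk z.1) y (na z'.2) = 1}.
  move=> zs /allP Rz; have := sum_le_size Rz; rewrite sN big_split /=.
  rewrite (sum_arcs1 s (fun q => E a x (nb q))) (sum_arcs2 s (fun q => E (nk z.1) y (na q))).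
  have h3 := cyc_degX a cs (mem_head _ _) Xx.
  have h4 : d <= E (nk z.1) y x + \sum_(r <- s) E (nk z.1) y (na r).
    by apply: cyc_degY cs _ Xy; rewrite !inE eqxx orbT.
  move=> h5; have [e1 [e2 e3]] : 2 * d = N + 2 /\ \sum_(q <- s) E a x (nb q) = d.-1 /\
      N <= \sum_(r <- s) E a x (nb r) + \sum_(r <- s) E (nk z.1) y (na r).
    move: D h3 h4 h5; move: (\sum_(r <- s) _) (\sum_(r <- s) _) (E a x y) (E _ y x).
    by clear => S1 S2 [] [] /=; lia.
  split=> //; split=> //; apply: sum_eq_size => //.
  rewrite sN big_split /= (sum_arcs1 s (fun q => E a x (nb q))).
  by rewrite (sum_arcs2 s (fun q => E (nk z.1) y (na q))).
(* If no arc resisted, every [rho] would be at most [N], below the average. *)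
have [z0 z0s Rz0] : exists2 z0, z0 \in arcs s & R z0.
  apply/hasP; apply: contraLR lb => /hasPn nR; rewrite -ltnNge.
  have : \sum_(z <- arcs s) rho s z <= size (arcs s) * N.
    by apply: sum_le_mul => z zs; have := A z zs (nR z zs); move: D; clear; lia.
  rewrite sN; have : N * (N + 2) <= N * (2 * d) by rewrite leq_mul2l D orbT.
  by move: D N0; clear; lia.
have [D' [SX _]] := RX z0 z0s Rz0.
have d2 : 1 < d by move: D' N0; clear; lia.
(* At such a change the second node [j] admits the insertion: [x] sees [nb j] in colour [a], and
   since it misses the node before, [y] sees [na j] in the colour of every resisting arc. *)
have [||zj zjs /andP[Pz1 Pz2]] := @arcs_rise _ s (fun q => E a x (nb q)).
- by rewrite has_count -sum_bool SX; move: d2; clear; lia.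
- by rewrite all_count -sum_bool SX -/N; apply/eqP; move: D' d2; clear; lia.
pose j := zj.2; have js : j \in s by have [t [_ _ /perm_mem <- _]] := op zj zjs; rewrite mem_head.
pose tj (z : node V C * node V C) := E (nl j) (nb z.1) (na j) + E (nl j) (na z.2) (nb j).
have B z : z \in arcs s -> rho s z <= N \/ rho s z + 1 <= N + tj z.
  move=> zs; case: (boolP (R z)) => [Rz|/(A z zs)]; last by move: D'; clear; left; lia.
  have [_ [_ ex]] := RX z zs Rz; right.
  have := ex zj zjs; rewrite (negbTE Pz1) add0n => /eqP; rewrite eqb1 => eyj.
  have [t [ct lt pt at_]] := op z zs.
  have jT : j \in z.2 :: t by rewrite (perm_mem pt).
  have := rho_node ct jT; rewrite lt => /(_ Pz2 eyj).
  have := ex z zs; rewrite [E _ y _]Esym [E _ x _]Esym addnC => ->.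
  rewrite (perm_size pt) -/N -/(tj z) [rho _ _](_ : _ = rho s z); last by rewrite /rho (perm_big _ pt).
  by move: D'; move: (rho s z) (tj z); clear; lia.
have tj2 z : tj z <= 2 by rewrite /tj; case: (E _ _ _); case: (E _ _ _).
(* Each value is at most [N + 1], which the average attains. *)
have B1 : {in arcs s, forall z, rho s z = N.+1}.
  apply: sum_eq_mul => [z zs|].
    by have := B z zs; have := tj2 z; clear; lia.
  rewrite sN; move: lb; rewrite D' mulnDr; move: (\sum_(z <- arcs s) rho s z) (N).
  by clear => S M; rewrite [M * M.+1]mulnS; move: (M * M); lia.
(* The value [N + 1] forces [tj z = 2] for every arc. *)
have full : {in s, forall q, E (nl j) (na j) (nb q)}.
  move=> q; rewrite -(@unzip1_zip _ _ s (rot 1 s)) ?size_rot // => /mapP[z zs ->].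
  have := B z zs; rewrite (B1 z zs) /tj Esym.
  by case: (E _ (na j) _) => //; case: (E _ _ _) => /=; clear; lia.
(* Recounting with the full degree of [na j], the surplus [N - d] must vanish, which leaves
   [N = 2]. *)
have lb2 : \sum_(r <- s) (2 * d + (r == j) * (N - d)) + 2 * d <=
    \sum_(z <- arcs s) rho s z + 2 * N + 2.
  apply: (rho_sum cs) => r rs; have [h1 h2] := deg2 r rs.
  case: (r =P j) => [rj|_]; last by rewrite mul0n addn0 mul2n -addnn leq_add.
  have : \sum_(q <- s) E (nl r) (na r) (nb q) = N.
    rewrite sum_bool; apply/eqP; rewrite -all_count; apply/allP => q qs.
    by rewrite rj; exact: full.
  move: h1 h2; move: (\sum_(q <- s) _) (\sum_(q <- s) _) (E _ _ x) (E _ _ y).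
  by clear => S1 S2 [] [] /=; lia.
have Nd : N <= d.
  have e : \sum_(z <- arcs s) rho s z = N * N.+1.
    by rewrite -{1}sN -sum_const big_seq [RHS]big_seq; apply: eq_bigr => z /B1.
  move: lb2; rewrite e big_split /= sum_const -/N -big_distrl /= sum_bool.
  have : 0 < count_mem j s by rewrite -has_count has_pred1.
  move: (count_mem j s) => c c0; have : N - d <= c * (N - d) by rewrite leq_pmull.
  rewrite D' mulnDr; move: (N) => M; move: (c * _) => c1; clear.
  by rewrite [M * M.+1]mulnS; move: (M * M); lia.
have N2 : N = 2 by move: Nd D' N0; clear; lia.
move: N2 cs; rewrite /N; case: (s) => [|q0 [|q1 [|]]] // _.
exact: no_square.
Qed.

End NoPath.
End Cycles.

(** * From rainbow walks to transversals *)

Lemma path_edges_sub (V : finType) (u : V) p e : e \in path_edges u p -> {subset e <= u :: p}.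
Proof.
elim: p u => [|v p IH] u /=; first by rewrite inE.
rewrite in_setU1 => /orP[/eqP-> a|/IH H a /H]; last by rewrite [in X in _ -> X]inE => ->; rewrite orbT.
by rewrite !inE => /orP[->|->]; rewrite ?orbT.
Qed.

Section Transversal.
Variables (V : finType) (k : nat) (G : 'I_k -> sgraph V).
Let E c : rel V := fun u v => [set u; v] \in edges (G c).

Lemma cwalk_transversal u w vs cs : 'I_k -> cwalk E u w vs cs -> uniq vs -> uniq cs ->
  exists p phi, [/\ last u p = w, perm_eq (u :: p) vs, transversal_on G (path_edges u p) phi
    & {in path_edges u p, forall e, phi e \in cs}].
Proof.
move=> c0; elim=> [{}u _ _|c {}u v {}w {}vs {}cs vs' cs' e _ IH pv pc].
  exists [::], (fun=> c0); split=> //=.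
    by split=> [e1 e2|e]; rewrite ?inE.
  by move=> e; rewrite inE.
rewrite (perm_uniq pv) (perm_uniq pc) => /= /andP[uvs /IH{}IH] /andP[ccs /IH].
case=> p [phi [lp pp [inj tr] incs]].
(* As [u] lies on no later edge, redefining [phi] at the edge [u v] leaves the other colours
   intact. *)
exists (v :: p), (fun f => if f == [set u; v] then c else phi f).
have new f : f \in path_edges v p -> (f == [set u; v]) = false.
  move=> /path_edges_sub sub; apply/eqP => ef; have := sub u.
  by rewrite ef set21 (perm_mem pp) (negbTE uvs) => /(_ isT).
split=> //=; first by apply: perm_trans (_ : perm_eq _ (u :: vs)) _; rewrite ?perm_cons // perm_sym.
- split=> [f1 f2|f]; rewrite !in_setU1.
    move=> /orP[/eqP->|f1p] /orP[/eqP->|f2p] //; rewrite ?eqxx ?new //.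
    + by move=> ec; rewrite ec incs in ccs.
    + by move=> ec; rewrite -ec incs in ccs.
    + exact: inj.
  by case/orP=> [/eqP->|fp]; [rewrite eqxx|rewrite new // tr].
move=> f; rewrite in_setU1 (perm_mem pc) inE => /orP[/eqP->|fp]; first by rewrite !eqxx.
by rewrite new // incs ?orbT.
Qed.
End Transversal.

Lemma bigmin_le (T : eqType) (s : seq T) (f : T -> nat) k v :
  v \in s -> \big[minn/k]_(u <- s) f u <= f v.
Proof.
elim: s => // u s IH; rewrite inE big_cons => /orP[/eqP->|/IH]; first exact: geq_minl.
exact/leq_trans/geq_minr.
Qed.

(** * Application to the given graphs and the extremal structure *)

Section Main.
Variables (n : nat) (V : finType) (X Y : {set V}) (G : 'I_(2 * n - 1) -> sgraph V).
Hypotheses (n0 : 0 < n) (XY : is_bipartition X Y) (cX : #|X| = n) (cY : #|Y| = n).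
Hypothesis Gbip : forall i, bipartite_on X Y (G i).
Hypothesis Gdeg : forall i, uphalf (n + 1) <= min_degree (G i).
Variables (x y : V).
Hypotheses (xX : x \in X) (yY : y \in Y).

Let E c : rel V := fun u v => [set u; v] \in edges (G c).
Let vs := [seq v <- enum V | v \notin [:: x; y]].

Lemma memY v : (v \in Y) = (v \notin X).
Proof.
have [dXY UXY] := XY; have : v \in X :|: Y by rewrite UXY inE.
rewrite inE; case: (boolP (v \in X)) => //= vX _.
by rewrite (disjointFr dXY vX).
Qed.

Lemma Esym c : symmetric (E c).
Proof. by move=> u v; rewrite /E setUC. Qed.

Lemma Ebip c a b : E c a b -> (a \in X) = ~~ (b \in X).
Proof.
move=> e; have [u [v [uX vY ee]]] := Gbip e.
have ab : a != b by have := edges_card2 e; rewrite cards2; case: (a != b).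
have : a \in [set u; v] by rewrite -ee set21.
have : b \in [set u; v] by rewrite -ee set22.
rewrite memY in vY.
rewrite !inE => /orP[/eqP eb|/eqP eb] /orP[/eqP ea|/eqP ea]; rewrite ea eb ?uX ?(negbTE vY) //.
- by rewrite ea eb eqxx in ab.
- by rewrite ea eb eqxx in ab.
Qed.

Lemma uniq_vs : uniq (x :: y :: vs).
Proof.
rewrite /= !inE !mem_filter !inE !eqxx orbT /= filter_uniq ?enum_uniq // !andbT.
by apply/norP; split=> //; apply/eqP => e; have := yY; rewrite memY -e xX.
Qed.

Lemma vs_uniq : uniq vs.
Proof. by rewrite filter_uniq ?enum_uniq. Qed.

Lemma perm_vs : perm_eq (x :: y :: vs) (enum V).
Proof.
apply: uniq_perm; rewrite ?uniq_vs ?enum_uniq // => v.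
rewrite !inE mem_filter mem_enum !inE andbT negb_or.
by case: (v == x); case: (v == y).
Qed.

Lemma count_vs (P : pred V) : count P (x :: y :: vs) = #|[set v | P v]|.
Proof.
rewrite (permP perm_vs) cardE -size_filter; apply/perm_size/uniq_perm; rewrite ?filter_uniq -?enumT ?enum_uniq //.
by move=> v; rewrite mem_filter !mem_enum !inE andbT.
Qed.

Lemma degE c v : v \in x :: y :: vs -> uphalf (n + 1) <= count (E c v) (x :: y :: vs).
Proof.
move=> _; rewrite count_vs; apply: leq_trans (Gdeg c) _.
by apply: bigmin_le; rewrite mem_index_enum.
Qed.


Lemma size_vs : size vs = (n.-1).*2.
Proof.
have := count_vs predT; rewrite count_predT /=.
have -> : [set v | predT v] = X :|: Y by have [_ ->] := XY; apply/setP => v; rewrite !inE.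
have [dXY _] := XY; rewrite cardsU cX cY (disjoint_setI0 dXY) cards0; lia.
Qed.

Lemma count_side (P : pred V) : count (fun v => (v \in X) && P v) vs = #|[set v in X | (v != x) && P v]|
  /\ count (fun v => (v \notin X) && P v) vs = #|[set v in Y | (v != y) && P v]|.
Proof.
have uv := uniq_vs; have mv v : v \in vs = (v != x) && (v != y).
  by rewrite mem_filter mem_enum !inE andbT negb_or.
have yX : y \notin X by rewrite -memY.
have xY : x \notin Y by rewrite memY xX.
split; rewrite -size_filter cardE; apply/perm_size/uniq_perm;
  rewrite ?(filter_uniq _ vs_uniq) ?enum_uniq // => v; rewrite mem_filter mv mem_enum !inE.
  case: (v =P y) => [->|_]; first by rewrite (negbTE yX) !andbF.
  by rewrite andbT -andbA; congr (_ && _); rewrite andbC.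
rewrite memY; case: (v =P x) => [->|_]; first by rewrite xX.
by rewrite /= -andbA; congr (_ && _); rewrite andbC.
Qed.

Lemma count_X : count (mem X) vs = n.-1 /\ count (predC (mem X)) vs = n.-1.
Proof.
have [h1 h2] := count_side predT.
have e1 : count (mem X) vs = count (fun v => (v \in X) && predT v) vs.
  by apply: eq_count => v /=; rewrite andbT.
have e2 : count (predC (mem X)) vs = count (fun v => (v \notin X) && predT v) vs.
  by apply: eq_count => v /=; rewrite andbT.
rewrite e1 e2 h1 h2.
have -> : [set v in X | (v != x) && predT v] = X :\ x.
  by apply/setP => v; rewrite !inE andbT andbC.
have -> : [set v in Y | (v != y) && predT v] = Y :\ y.
  by apply/setP => v; rewrite !inE andbT andbC.
have := cardsD1 x X; have := cardsD1 y Y; rewrite xX yY cX cY; lia.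
Qed.

Lemma path_or_blocks : (exists p phi, hamiltonian_path x y p /\ transversal_on G (path_edges x p) phi) \/
  0 < size vs /\ exists A : pred V, forall c a b, a \in vs -> a \in X -> b \in vs -> b \notin X ->
    E c a b = (A a == A b) /\ 4 * count (E c a) vs = size vs.
Proof.
have sv := size_vs; have [c1 c2] := count_X.
have yX : y \notin X by rewrite -memY.
have lt0 : 0 < 2 * n - 1 by lia.
pose c0 := Ordinal lt0.
have sC : size (enum 'I_(2 * n - 1)) = (size vs).+1 by rewrite size_enum_ord sv; lia.
have fin : cwalk E x y (x :: y :: vs) (enum 'I_(2 * n - 1)) ->
    exists p phi, hamiltonian_path x y p /\ transversal_on G (path_edges x p) phi.
  move=> W; have [p [phi [lp pp tr _]]] := cwalk_transversal c0 W uniq_vs (enum_uniq _).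
  exists p, phi; split=> //; split=> //; first by rewrite (perm_uniq pp) uniq_vs.
  by move=> v; rewrite (perm_mem pp) (perm_mem perm_vs) mem_enum.
(* For [n = 1] the path is the edge [x y] in the only colour. *)
case: (posnP (size vs)) => [vs0|vs_gt0].
  left; apply: fin; have := degE c0 (mem_head x (y :: vs)); rewrite (size0nil vs0) /= => dx.
  have exy : E c0 x y.
    move: dx; case: (boolP (E c0 x x)) => [/Ebip|_]; first by rewrite xX.
    by case: (E c0 x y) => //; lia.
  have c0e : c0 \in enum 'I_(2 * n - 1) by rewrite mem_enum.
  apply: (cwalkS exy (cwalk1 E y)) => //.
  move: c0e sC; rewrite vs0; case: (enum _) => [|c' [|]] //.
  by rewrite inE => /eqP->.
(* Only one of [x] and [y] is on the side opposite to [v], so deleting both costs at most one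
   neighbour. *)
have dv c v : v \in vs -> size vs <= 4 * count (E c v) vs.
  move=> vv; have := @degE c v; rewrite !inE vv !orbT => /(_ isT) /=; rewrite sv.
  case: (boolP (E c v x)) => [/Ebip e1|_]; case: (boolP (E c v y)) => [/Ebip e2|_];
    last 3 first; [lia|lia|lia|].
  by move: e1; rewrite e2 xX (negbTE yX).
have [|HP|[A HA]] := rainbow_path_or_blocks (X := mem X) vs_uniq (enum_uniq _) Esym Ebip
  (fun c v _ => dv c v) _ vs_gt0 sC.
- by rewrite c1 c2.
- have d_big : size vs + 4 <= 4 * uphalf (n + 1) by rewrite sv; lia.
  left; apply: NNPP => nP; have nF : ~ cwalk E x y (x :: y :: vs) (enum 'I_(2 * n - 1)) by move/fin.
  have [a [s cs]] := cycle_of_path (X := mem X) Esym Ebip xX yX degE d_big HP nF.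
  exact: (no_cycle (X := mem X) Esym Ebip xX yX degE d_big nF vs_gt0 cs).
right; split=> //; exists A => c a b av aX bv bX.
by apply: HA => //; rewrite mem_enum.
Qed.

Section Blocks.
Hypothesis vs_gt0 : 0 < size vs.
Variable A : pred V.
Hypothesis HA : forall c a b, a \in vs -> a \in X -> b \in vs -> b \notin X ->
    E c a b = (A a == A b) /\ 4 * count (E c a) vs = size vs.

Let XA i := [set v in X | (v != x) && (A v == i)].
Let YA i := [set v in Y | (v != y) && (A v == i)].

Lemma mem_vs v : (v \in vs) = (v != x) && (v != y).
Proof. by rewrite mem_filter mem_enum !inE andbT negb_or. Qed.

Lemma degX c a : a \in vs -> a \in X -> count (E c a) vs = #|YA (A a)|.
Proof.
move=> av aX; have [_ <-] := count_side (fun b => A b == A a).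
apply: eq_in_count => b bv; case: (boolP (b \in X)) => bX /=.
  by apply/negP => /Ebip; rewrite aX bX.
by have [-> _] := HA c av aX bv bX; rewrite eq_sym.
Qed.

Lemma degY c b : b \in vs -> b \notin X -> count (E c b) vs = #|XA (A b)|.
Proof.
move=> bv bX; have [<- _] := count_side (fun a => A a == A b).
apply: eq_in_count => a av; case: (boolP (a \in X)) => aX /=.
  by rewrite Esym; have [-> _] := HA c av aX bv bX.
by apply/negP => /Ebip; rewrite (negbTE aX) (negbTE bX).
Qed.

Lemma deg_vsX c a : a \in vs -> a \in X -> uphalf (n + 1) <= E c a y + count (E c a) vs.
Proof.
move=> av aX; have := @degE c a; rewrite !inE av !orbT => /(_ isT) /=.
suff -> : E c a x = false by [].
by apply/negP => /Ebip; rewrite aX xX.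
Qed.

Lemma deg_vsY c b : b \in vs -> b \notin X -> uphalf (n + 1) <= E c b x + count (E c b) vs.
Proof.
move=> bv bX; have := @degE c b; rewrite !inE bv !orbT => /(_ isT) /=.
suff -> : E c b y = false by [].
by apply/negP => /Ebip; rewrite (negbTE bX) -memY yY.
Qed.

(** A vertex of [X] has exactly a quarter of [size vs] as its degree in [vs], which fixes one [YA j]
    and, by complement, the other. Degrees of vertices of [Y] bound each [XA j] from below by the
    same number, and these bounds already sum to [n - 1]. *)
Lemma card_blocks i : [/\ odd n, #|XA i| = (n - 1)./2 & #|YA i| = (n - 1)./2].
Proof.
have sv := size_vs; have [c1 c2] := count_X.
have lt0 : 0 < 2 * n - 1 by lia.
pose c0 := Ordinal lt0.
have split_card (Z : {set V}) z : z \in Z -> #|Z| = n ->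
    #|[set v in Z | (v != z) && (A v == true)]| + #|[set v in Z | (v != z) && (A v == false)]| = n.-1.
  move=> zZ cZ; have -> : n.-1 = #|Z :\ z| by have := cardsD1 z Z; rewrite zZ cZ; lia.
  rewrite -(cardsID [set v | A v] (Z :\ z)); congr (_ + _); apply: eq_card => v; rewrite !inE;
    by case: (v \in Z); case: (v == z); case: (A v).
have sX : #|XA true| + #|XA false| = n.-1 by exact: split_card.
have sY : #|YA true| + #|YA false| = n.-1 by exact: split_card.
have [a0 av aX] : exists2 a, a \in vs & a \in X.
  by apply/hasP; rewrite has_count c1; lia.
have [b0 bv bX] : exists2 b, b \in vs & b \notin X.
  by apply/hasP; rewrite has_count [count _ _]c2; lia.
have YA4 j : 4 * #|YA j| = size vs.
  have [_] := HA c0 av aX bv bX; rewrite degX // sv; move: sY.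
  by case: (A a0); case: j; move: #|YA true| #|YA false|; clear; lia.
have XA4 j : size vs <= 4 * #|XA j|.
  have : 0 < #|YA j| by have := YA4 j; lia.
  rewrite card_gt0 => /set0Pn[b]; rewrite inE => /and3P[bY by_ /eqP Ab].
  have bv' : b \in vs.
    by rewrite mem_vs by_ andbT; apply/eqP => bx; move: bY; rewrite memY bx xX.
  have bX' : b \notin X by rewrite -memY.
  have := deg_vsY c0 bv' bX'; rewrite degY // Ab sv.
  by case: (E _ _ _) => /=; move: #|XA j|; clear; lia.
have := YA4 i; have := XA4 true; have := XA4 false; move: sX; rewrite sv.
case: i; move: #|XA true| #|XA false| #|YA _| => ? ? ?; clear -n0 => h1 h2 h3 h4.
  by split; lia.
by split; lia.
Qed.

(** The blocks give [v] only [(n - 1) / 2] neighbours in [vs], one fewer than required, so the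
    deleted vertex on the other side must be adjacent to it. *)
Lemma star_edges c v : v \in vs -> E c v (if v \in X then y else x).
Proof.
move=> vv; case: (boolP (v \in X)) => vX.
  have := deg_vsX c vv vX; rewrite degX //; have [on _ ->] := card_blocks (A v).
  by case: (E _ _ _) => //=; move: on n0; clear; lia.
have := deg_vsY c vv vX; rewrite degY //; have [on -> _] := card_blocks (A v).
by case: (E _ _ _) => //=; move: on n0; clear; lia.
Qed.

Lemma block_edges c e : (e \in edges (G c)) =
  E c x y && (e == [set x; y]) || (e \in F_edges x y (XA true) (XA false) (YA true) (YA false)).
Proof.
have XAvs i v : v \in XA i -> [/\ v \in vs, v \in X & A v = i].
  rewrite inE => /and3P[vX vx /eqP Av]; split=> //; rewrite mem_vs vx.
  by apply/eqP => vy; move: yY; rewrite memY -vy vX.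
have YAvs i v : v \in YA i -> [/\ v \in vs, v \notin X & A v = i].
  rewrite inE => /and3P[vY vy /eqP Av]; split=> //; last by rewrite -memY.
  by rewrite mem_vs vy andbT; apply/eqP => vx; move: vY; rewrite memY vx xX.
apply/idP/idP.
  move=> ee; have [a [b [aX bY eab]]] := Gbip ee; rewrite /F_edges !in_setU eab.
  have bX : b \notin X by rewrite -memY.
  have Eab : E c a b by rewrite /E -eab.
  case: (a =P x) => [ax|/eqP ax]; case: (b =P y) => [by_|/eqP by_].
  - by rewrite ax by_ in Eab *; rewrite Eab eqxx.
  - apply/orP; right; apply/orP; left; apply/orP; left; apply/orP; left; rewrite ax.
    by apply: imset_f; rewrite !inE bY by_ /=; case: (A b).
  - apply/orP; right; apply/orP; left; apply/orP; left; apply/orP; right; rewrite by_.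
    by apply: imset_f; rewrite !inE aX ax /=; case: (A a).
  have av : a \in vs by rewrite mem_vs ax; apply/eqP => ay; move: aX; rewrite ay; apply/negP; rewrite -memY.
  have bv : b \in vs by rewrite mem_vs by_ andbT; apply/eqP => bx; move: bX; rewrite bx xX.
  have [e1 _] := HA c av aX bv bX; move: Eab; rewrite e1 => /eqP Aab.
  apply/orP; right; apply/orP; case Ab: (A b); [left; apply/orP; right|right];
    by apply: imset2_f; rewrite inE ?aX ?bY ?ax ?by_ /= ?Aab ?Ab.
rewrite /F_edges !in_setU => /orP[/andP[exy /eqP->//]|].
have XE i j a b : a \in XA i -> b \in YA j -> i == j -> [set a; b] \in edges (G c).
  move=> /XAvs[av aX Aa] /YAvs[bv bX Ab] ij.
  by have [e1 _] := HA c av aX bv bX; rewrite -[_ \in _]/(E c a b) e1 Aa Ab.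
have XS i a : a \in XA i -> [set a; y] \in edges (G c).
  by move=> /XAvs[av aX _]; have := star_edges c av; rewrite aX.
have YS i b : b \in YA i -> [set x; b] \in edges (G c).
  by move=> /YAvs[bv bX _]; have := star_edges c bv; rewrite (negbTE bX) Esym.
case/orP=> [/orP[/orP[|]|]|].
- by case/imsetP => b; rewrite in_setU => /orP[] /YS h ->.
- by case/imsetP => a; rewrite in_setU => /orP[] /XS h ->.
- by case/imset2P => a b aX bY ->; apply: XE aX bY _.
- by case/imset2P => a b aX bY ->; apply: XE aX bY _.
Qed.

Lemma blocks_extremal : odd n /\ exists (xs ys : V) (X1 X2 Y1 Y2 : {set V}),
  [/\ split_side n X xs X1 X2, split_side n Y ys Y1 Y2 &
    forall i, edges (G i) = F_edges xs ys X1 X2 Y1 Y2 \/ edges (G i) = F'_edges xs ys X1 X2 Y1 Y2].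
Proof.
have [on XAt YAt] := card_blocks true; have [_ XAf YAf] := card_blocks false.
split=> //; exists x, y, (XA true), (XA false), (YA true), (YA false); split.
- split=> //.
  + apply/setP => v; rewrite !inE -andb_orr -andb_orr.
    by case: (v =P x) => [->|_] /=; rewrite ?xX //; case: (A v); rewrite andbT.
  + by rewrite !inE eqxx /= !andbF.
  + by apply/pred0P => v /=; rewrite !inE; case: (A v); rewrite !andbF.
- split=> //.
  + apply/setP => v; rewrite !inE -andb_orr -andb_orr.
    by case: (v =P y) => [->|_] /=; rewrite ?yY //; case: (A v); rewrite andbT.
  + by rewrite !inE eqxx /= !andbF.
  + by apply/pred0P => v /=; rewrite !inE; case: (A v); rewrite !andbF.
move=> i; case Exy : (E i x y); [right|left]; apply/setP => e; rewrite block_edges Exy //.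
by rewrite /F'_edges in_setU1.
Qed.

End Blocks.
End Main.

Theorem theorem1p4 (n : nat) (V : finType) (X Y : {set V})
    (G : 'I_(2 * n - 1) -> sgraph V) :
  0 < n ->
  is_bipartition X Y -> #|X| = n -> #|Y| = n ->
  (forall i, bipartite_on X Y (G i)) ->
  (forall i, uphalf (n + 1) <= min_degree (G i)) ->
  hamiltonian_connected X Y G
  \/ (odd n /\
      exists (xs ys : V) (X1 X2 Y1 Y2 : {set V}),
        [/\ split_side n X xs X1 X2, split_side n Y ys Y1 Y2 &
            forall i, edges (G i) = F_edges xs ys X1 X2 Y1 Y2
                   \/ edges (G i) = F'_edges xs ys X1 X2 Y1 Y2]).
Proof.
move=> n0 XY cX cY Gbip Gdeg; set ext := odd n /\ _.
(* Outside the extremal case a path is needed for each pair; a single pair yielding blocks would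
   already make the collection extremal. *)
case: (classic ext) => [|next]; [by right | left=> x y xX yY].
case: (path_or_blocks n0 XY cX cY Gbip Gdeg xX yY) => // -[vs_gt0 [A HA]].
by case: next; exact: (blocks_extremal n0 XY cX cY Gbip Gdeg xX yY vs_gt0 HA).
Qed.
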